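(* Let $\mathbf A\in\mathbb R^{m\times m}$ be a symmetric positive semidefinite matrix of rank $r_A$ with largest singular value $\sigma_1(\mathbf A)=1$ and smallest nonzero singular value $\sigma_{r_A}(\mathbf A)=\frac1\kappa$, where $\kappa>1$. Consider solving the matrix factorization problem $$\min_{\mathbf X\in\mathsf{St}(m,r),\,\mathbf\Theta\in\mathbb S^r}\tfrac14\|\mathbf X\mathbf\Theta\mathbf X^\top-\mathbf A\|_{\mathsf F}^2$$ using recursive DMD (defined in the context) with stepsizes $\eta=\mathcal O(1)$, $\mu=2$ and largest number of rounds $r>r_A$. For any $\varepsilon\in(0,\frac1{\kappa^2})$, set the number of iterations $$T_\star=\mathcal O\big(\kappa(\log(m)+r_A)+\kappa\log(\tfrac1\varepsilon)\big)$$ for each round of rank-1 DMD. Suppose that $m\ge3$ and $\frac{\sigma_i(\mathbf A)}{\sigma_{i+1}(\mathbf A)}\ge2$ for $i=1,\dots,r_A-1$. With high probability over the initialization, $$\frac14\Big\|\sum_{j=0}^{J-1}\theta^{(j)}_{T_\star}\mathbf x^{(j)}_{T_\star}(\mathbf x^{(j)}_{T_\star})^\top-\mathbf A\Big\|_{\mathsf F}^2\le\varepsilon$$ after at most $$T_\varepsilon=\mathcal O\big(\kappa(r_A\log(m)+r_A^2)+r_A\kappa\log(\tfrac1\varepsilon)\big)$$ iterations in total. Here $J$ is the total number of calls to rank-1 DMD, and satisfies $J\le r_A$.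
   Context: $\|\cdot\|$ is the Euclidean norm, $\|\cdot\|_{\mathsf F}$ the Frobenius norm, $\sigma_i(\cdot)$ the $i$-th largest singular value, $\mathbb S^r$ the set of symmetric $r\times r$ matrices, and $\mathsf{St}(m,r)=\{\mathbf X\in\mathbb R^{m\times r}:\mathbf X^\top\mathbf X=\mathbf I_r\}$ the Stiefel manifold, so that $\mathsf{St}(m,1)$ is the unit sphere of $\mathbb R^m$. DMD stands for direction–magnitude decomposition. Rank-1 DMD with inputs $\mathbf x_0\in\mathsf{St}(m,1)$, symmetric matrix $\mathbf B\in\mathbb R^{m\times m}$, stepsizes $\eta,\mu$ and number of iterations $T$: for $t=0,1,\dots,T$, set $\theta_t=\theta_{t-1}-\frac\mu2(\theta_{t-1}-\mathbf x_t^\top\mathbf B\mathbf x_t)$ (so $\theta_t=\mathbf x_t^\top\mathbf B\mathbf x_t$ when $\mu=2$), $\mathbf y_{t+1}=\mathbf x_t+\eta(\mathbf I_m-\mathbf x_t\mathbf x_t^\top)\mathbf B\mathbf x_t$, and $\mathbf x_{t+1}=\mathbf y_{t+1}/\|\mathbf y_{t+1}\|$. The output is $(\mathbf x_T,\theta_T)$. Recursive DMD with inputs $\mathbf A$, target error $\varepsilon$, largest number of rounds $r$, stepsizes $\eta,\mu$ and iterations per round $T_\star$: set $\mathbf A^{(0)}=\mathbf A$. For $j=0,1,\dots,r-1$: generate a random $\mathbf x_0^{(j)}\in\mathsf{St}(m,1)$ (sampled uniformly, e.g. by normalizing a vector with i.i.d. $\mathcal N(0,1)$ entries); run rank-1 DMD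 with inputs $\mathbf x_0^{(j)},\mathbf A^{(j)},\eta,\mu,T_\star$ to obtain $\mathbf x^{(j)}_{T_\star},\theta^{(j)}_{T_\star}$; set $\mathbf A^{(j+1)}=\mathbf A^{(j)}-\theta^{(j)}_{T_\star}\mathbf x^{(j)}_{T_\star}(\mathbf x^{(j)}_{T_\star})^\top$; if $\frac14\|\mathbf A^{(j+1)}\|_{\mathsf F}^2\le\varepsilon$, set $J=j+1$ and stop. The output is $\mathbf x^{(j)}_{T_\star},\theta^{(j)}_{T_\star}$, $j=0,\dots,J-1$. *)

(* Defs.v *)
From mathcomp Require Import all_boot all_order all_algebra.
From mathcomp Require Import polyrcf.
From mathcomp Require Import all_classical all_reals all_analysis.
Import Order.TTheory GRing.Theory Num.Theory.
Import numFieldNormedType.Exports.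

Set Implicit Arguments.
Unset Strict Implicit.
Unset Printing Implicit Defensive.

Local Open Scope classical_set_scope.
Local Open Scope ring_scope.

(* The library norm on matrices is the sup norm, hence explicit norms here. *)
Definition frobenius (R : realType) (m n : nat) (A : 'M[R]_(m, n)) : R :=
  Num.sqrt (\sum_i \sum_j A i j ^+ 2).

Definition euclid (R : realType) (m : nat) (x : 'cV[R]_m) : R :=
  Num.sqrt (\sum_i x i 0 ^+ 2).

Definition stiefel (R : realType) (m r : nat) : set 'M[R]_(m, r) :=
  [set X | X^T *m X = 1%:M].
Arguments stiefel : clear implicits.

Definition psdmx (R : realType) (m : nat) (A : 'M[R]_m) : Prop :=
  A^T = A /\ forall x : 'cV[R]_m, 0 <= (x^T *m A *m x) 0 0.

(* Real eigenvalues with their multiplicities as roots of the characteristic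
   polynomial; for a symmetric matrix these are all the eigenvalues. *)
Definition eigenvalues (R : realType) (n : nat) (A : 'M[R]_n) : seq R :=
  flatten [seq nseq (mup a (char_poly A)) a | a <- rootsR (char_poly A)].

Definition singular_values (R : realType) (m n : nat) (A : 'M[R]_(m, n)) :
    seq R :=
  sort >=%R [seq Num.sqrt a | a <- eigenvalues (A^T *m A)].

(* Indices start at 1. *)
Definition singular_value (R : realType) (m n : nat) (A : 'M[R]_(m, n))
    (i : nat) : R :=
  nth 0 (singular_values A) i.-1.

Definition rayleigh (R : realType) (m : nat) (B : 'M[R]_m) (x : 'cV[R]_m) : R :=
  (x^T *m B *m x) 0 0.

Definition direction_step (R : realType) (m : nat) (B : 'M[R]_m) (eta : R)
    (x : 'cV[R]_m) : 'cV[R]_m :=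
  let y := x + eta *: ((1%:M - x *m x^T) *m B *m x) in
  (euclid y)^-1 *: y.

Definition magnitude_step (R : realType) (m : nat) (B : 'M[R]_m) (mu : R)
    (x : 'cV[R]_m) (theta : R) : R :=
  theta - mu / 2 * (theta - rayleigh B x).

(* The pair (x_t, theta_t).  The recursion for theta_0 refers to theta_{-1},
   which is taken to be 0; it is irrelevant when mu = 2. *)
Fixpoint rank1_dmd (R : realType) (m : nat) (x0 : 'cV[R]_m) (B : 'M[R]_m)
    (eta mu : R) (t : nat) : 'cV[R]_m * R :=
  match t with
  | 0 => (x0, magnitude_step B mu x0 0)
  | t'.+1 =>
      let s := rank1_dmd x0 B eta mu t' in
      let x := direction_step B eta s.1 in
      (x, magnitude_step B mu x s.2)
  end.

Definition rank1_of (R : realType) (m : nat) (o : 'cV[R]_m * R) : 'M[R]_m :=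
  o.2 *: (o.1 *m o.1^T).

(* The list of outputs of the successive calls to rank-1 DMD.  The maximal
   number of rounds is the length of the list inits of initial points; the
   number J of rounds actually performed is the length of the result. *)
Fixpoint recursive_dmd (R : realType) (m : nat) (A : 'M[R]_m) (eps : R)
    (eta mu : R) (T : nat) (inits : seq 'cV[R]_m) : seq ('cV[R]_m * R) :=
  match inits with
  | [::] => [::]
  | x0 :: inits' =>
      let o := rank1_dmd x0 A eta mu T in
      let A' := A - rank1_of o in
      o :: (if 1 / 4 * frobenius A' ^+ 2 <= eps then [::]
            else recursive_dmd A' eps eta mu T inits')
  end.

Definition borel_vec (R : realType) (m : nat) : set (set 'cV[R]_m) :=
  <<s [set U : set 'cV[R]_m | open U] >>.
Arguments borel_vec : clear implicits.

Definition random_vector d (Omega : measurableType d) (R : realType) (m : nat)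
    (X : Omega -> 'cV[R]_m) : Prop :=
  forall B, borel_vec R m B -> measurable (X @^-1` B).

(* The uniform distribution on the unit sphere St(m, 1) is its unique Borel
   probability measure that is invariant under all orthogonal matrices (the
   distribution of g / |g| for g with i.i.d. N(0, 1) entries). *)
Definition uniform_on_sphere d (Omega : measurableType d) (R : realType)
    (P : probability Omega R) (m : nat) (X : Omega -> 'cV[R]_m) : Prop :=
  [/\ random_vector X,
      forall w, stiefel R m 1 (X w) &
      forall (Q : 'M[R]_m) (B : set 'cV[R]_m),
        stiefel R m m Q -> borel_vec R m B ->
        P [set w | B (Q *m X w)] = P (X @^-1` B)].

Definition independent_vectors d (Omega : measurableType d) (R : realType)
    (P : probability Omega R) (m r : nat) (X : 'I_r -> Omega -> 'cV[R]_m) :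
    Prop :=
  forall (I : {set 'I_r}) (B : 'I_r -> set 'cV[R]_m),
    (forall j, borel_vec R m (B j)) ->
    P (\bigcap_(j in [set` I]) (X j @^-1` B j)) =
      (\prod_(j in I) P (X j @^-1` B j))%E.

(* Main.v *)
Require Import Defs.
From mathcomp Require Import all_boot all_order all_algebra.
From mathcomp Require Import polyrcf perm spectral sesquilinear complex.
From mathcomp Require Import ring lra.
From mathcomp Require Import all_classical all_reals all_analysis.
From mathcomp Require Import measurable_realfun.
Import Order.TTheory GRing.Theory Num.Theory.
Import numFieldNormedType.Exports.
Local Open Scope classical_set_scope.
Local Open Scope ring_scope.

(* Let A = sum_i l_i u_i u_i^T with l_1 >= l_2 >= ... and M_j = sum_(i >= j) l_i u_i u_i^T.
   One direction step maps x to a multiple of (p + eta B) x for a scalar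
   p = 1 - eta x^T B x, i.e. it is a shifted power iteration.  If
   |B - M_j| <= e, the tangent of the angle between x and u_j therefore
   contracts at rate 1 - eta l_j / 10 towards 5 e / l_j, so a round
   of T steps started at overlap delta with u_j leaves an error at most
   22 e + 4 (1 - eta / (10 kappa))^T / delta after deflation.  Over r_A
   rounds this only grows geometrically, which costs the r_A term in T.
   Since the errors stay far below delta / kappa, only the overlap of the j-th
   initial point with the deterministic vector u_j matters, and a union bound
   over the rounds suffices.

   P(|<u, X>| < delta) does not depend on the unit vector u by rotation
   invariance, so it may be averaged over u in the normalised grid
   {1, ..., K}^m.  For a fixed unit x with a coordinate |x_k| >= 1/m, at most one
   value of the k-th coordinate of the grid vector, given the others, puts
   it in the slab, hence the probability is at most 1/K. *)

(** * Frobenius inner product *)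

Section Frobenius.
Context {R : realType}.

Definition inner {m n} (A B : 'M[R]_(m, n)) : R := \tr (A^T *m B).

Lemma innerE {m n} (A B : 'M[R]_(m, n)) :
  inner A B = \sum_i \sum_j A i j * B i j.
Proof.
rewrite /inner /mxtrace exchange_big; apply: eq_bigr => i _.
by rewrite mxE; apply: eq_bigr => j _; rewrite mxE.
Qed.

Lemma innerC {m n} (A B : 'M[R]_(m, n)) : inner A B = inner B A.
Proof. by rewrite /inner -mxtrace_tr trmx_mul trmxK. Qed.

Lemma innerDr {m n} (A B C : 'M[R]_(m, n)) :
  inner A (B + C) = inner A B + inner A C.
Proof. by rewrite /inner mulmxDr mxtraceD. Qed.

Lemma innerZr {m n} a (A B : 'M[R]_(m, n)) : inner A (a *: B) = a * inner A B.
Proof. by rewrite /inner -scalemxAr mxtraceZ. Qed.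

Lemma innerNr {m n} (A B : 'M[R]_(m, n)) : inner A (- B) = - inner A B.
Proof. by rewrite -scaleN1r innerZr mulN1r. Qed.

Lemma innerDl {m n} (A B C : 'M[R]_(m, n)) :
  inner (A + B) C = inner A C + inner B C.
Proof. by rewrite innerC innerDr !(innerC C). Qed.

Lemma innerZl {m n} a (A B : 'M[R]_(m, n)) : inner (a *: A) B = a * inner A B.
Proof. by rewrite innerC innerZr innerC. Qed.

Lemma innerNl {m n} (A B : 'M[R]_(m, n)) : inner (- A) B = - inner A B.
Proof. by rewrite innerC innerNr innerC. Qed.

Lemma frobenius_ge0 {m n} (A : 'M[R]_(m, n)) : 0 <= frobenius A.
Proof. exact: sqrtr_ge0. Qed.

Lemma frobenius_sqr {m n} (A : 'M[R]_(m, n)) : frobenius A ^+ 2 = inner A A.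
Proof.
rewrite innerE sqr_sqrtr; first by under eq_bigr do under eq_bigr do rewrite expr2.
by apply: sumr_ge0 => i _; apply: sumr_ge0 => j _; rewrite sqr_ge0.
Qed.

Lemma inner_ge0 {m n} (A : 'M[R]_(m, n)) : 0 <= inner A A.
Proof. by rewrite -frobenius_sqr sqr_ge0. Qed.

Lemma frobenius0 {m n} : frobenius (0 : 'M[R]_(m, n)) = 0.
Proof.
by apply/eqP; rewrite -sqrf_eq0 frobenius_sqr /inner mulmx0 mxtrace0.
Qed.

Lemma frobenius_eq0 {m n} (A : 'M[R]_(m, n)) : frobenius A = 0 -> A = 0.
Proof.
move=> A0; apply/matrixP => i j; rewrite mxE.
have := frobenius_sqr A; rewrite A0 expr0n /= innerE => /esym/eqP.
rewrite psumr_eq0 => [/allP/(_ i)|k _]; last first.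
  by apply: sumr_ge0 => ? _; rewrite -expr2 sqr_ge0.
rewrite mem_index_enum => /(_ isT); rewrite /= psumr_eq0 => [|k _]; last first.
  by rewrite -expr2 sqr_ge0.
by move=> /allP/(_ j); rewrite mem_index_enum => /(_ isT); rewrite /= -expr2 sqrf_eq0 => /eqP.
Qed.

(** Follows from the nonnegative squared norm of [inner B B *: A - inner A B *: B]; the case [B = 0]
    is split off so that a factor [inner B B] can be cancelled. *)
Lemma cauchy_schwarz {m n} (A B : 'M[R]_(m, n)) :
  `|inner A B| <= frobenius A * frobenius B.
Proof.
have [B0|Bn0] := eqVneq (frobenius B) 0.
  by rewrite (frobenius_eq0 _ B0) frobenius0 mulr0 /inner mulmx0 mxtrace0 normr0.
have Bgt0 : 0 < inner B B by rewrite -frobenius_sqr exprn_gt0// lt_def Bn0 frobenius_ge0.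
have := inner_ge0 (inner B B *: A - inner A B *: B).
rewrite !(innerDl, innerDr, innerNl, innerNr, innerZl, innerZr) (innerC B A).
rewrite [leRHS](_ : _ = inner B B * (inner A A * inner B B - inner A B ^+ 2)); last by ring.
rewrite pmulr_rge0// subr_ge0 -!frobenius_sqr -exprMn => h.
rewrite -(@ler_pXn2r _ 2)// ?nnegrE ?mulr_ge0 ?frobenius_ge0//.
by rewrite real_normK ?num_real.
Qed.

Lemma frobeniusD {m n} (A B : 'M[R]_(m, n)) :
  frobenius (A + B) <= frobenius A + frobenius B.
Proof.
rewrite -(@ler_pXn2r _ 2)// ?nnegrE ?addr_ge0 ?frobenius_ge0//.
rewrite sqrrD !frobenius_sqr innerDl !innerDr (innerC B A).
have := le_trans (ler_norm _) (cauchy_schwarz A B); lra.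
Qed.

Lemma frobeniusZ {m n} a (A : 'M[R]_(m, n)) :
  frobenius (a *: A) = `|a| * frobenius A.
Proof.
apply/eqP; rewrite -(@eqrXn2 _ 2)// ?mulr_ge0 ?frobenius_ge0//.
by rewrite exprMn !frobenius_sqr innerZl innerZr real_normK ?num_real// expr2 mulrA.
Qed.

Lemma frobeniusN {m n} (A : 'M[R]_(m, n)) : frobenius (- A) = frobenius A.
Proof. by rewrite -scaleN1r frobeniusZ normrN1 mul1r. Qed.

Lemma frobeniusT {m n} (A : 'M[R]_(m, n)) : frobenius A^T = frobenius A.
Proof.
apply/eqP; rewrite -(@eqrXn2 _ 2)// ?frobenius_ge0//.
by rewrite !frobenius_sqr /inner trmxK mxtrace_mulC.
Qed.

Lemma inner_mulmxE {m n p} (A : 'M[R]_(m, n)) (B : 'M[R]_(n, p)) i j :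
  (A *m B) i j = inner (row i A)^T (col j B).
Proof.
rewrite innerE mxE; apply: eq_bigr => k _.
by rewrite big_ord1 !mxE.
Qed.

(** Cauchy-Schwarz for each entry, seen as a row of [A] against a column of [B]; the squared norms
    of the rows and of the columns add up to the two squared norms. *)
Lemma frobeniusM {m n p} (A : 'M[R]_(m, n)) (B : 'M[R]_(n, p)) :
  frobenius (A *m B) <= frobenius A * frobenius B.
Proof.
rewrite -(@ler_pXn2r _ 2)// ?nnegrE ?mulr_ge0 ?frobenius_ge0//.
rewrite exprMn frobenius_sqr innerE.
have colE : frobenius B ^+ 2 = \sum_j frobenius (col j B) ^+ 2.
  rewrite frobenius_sqr innerE exchange_big; apply: eq_bigr => j _.
  rewrite frobenius_sqr innerE; apply: eq_bigr => i _.
  by rewrite big_ord1 !mxE.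
have rowE : frobenius A ^+ 2 = \sum_i frobenius (row i A)^T ^+ 2.
  rewrite frobenius_sqr innerE; apply: eq_bigr => i _.
  rewrite frobeniusT frobenius_sqr innerE big_ord1; apply: eq_bigr => j _.
  by rewrite !mxE.
rewrite colE rowE mulr_suml; apply: ler_sum => i _.
rewrite mulr_sumr; apply: ler_sum => j _.
rewrite inner_mulmxE -expr2 -exprMn -[leLHS]real_normK ?num_real//.
by rewrite ler_pXn2r ?nnegrE ?mulr_ge0 ?frobenius_ge0// cauchy_schwarz.
Qed.

Lemma euclidE {m} (x : 'cV[R]_m) : euclid x = frobenius x.
Proof.
by rewrite /euclid /frobenius; congr Num.sqrt; apply: eq_bigr => i _; rewrite big_ord1.
Qed.

Lemma mulmx_inner {m} (x y : 'cV[R]_m) : x^T *m y = (inner x y)%:M.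
Proof. by rewrite [LHS]mx11_scalar /inner trace_mx11. Qed.

Lemma rayleighE {m} (B : 'M[R]_m) (x : 'cV[R]_m) : rayleigh B x = inner x (B *m x).
Proof. by rewrite /rayleigh -mulmxA mulmx_inner mxE. Qed.

Lemma inner_sym_mulmx {m} (M : 'M[R]_m) (x y : 'cV[R]_m) : M^T = M ->
  inner x (M *m y) = inner (M *m x) y.
Proof. by move=> MT; rewrite /inner trmx_mul MT mulmxA. Qed.

Lemma outer_mul {m} (x y z : 'cV[R]_m) : x *m y^T *m z = inner y z *: x.
Proof. by rewrite -mulmxA mulmx_inner mul_mx_scalar. Qed.

Lemma inner_orthogonal {m} (Q : 'M[R]_m) (x y : 'cV[R]_m) : Q^T *m Q = 1%:M ->
  inner (Q *m x) (Q *m y) = inner x y.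
Proof. by move=> QQ; rewrite /inner trmx_mul mulmxA -(mulmxA _ Q^T) QQ mulmx1. Qed.

Lemma frobenius_unit {m} (x : 'cV[R]_m) : frobenius x = 1 <-> inner x x = 1.
Proof.
split=> [x1|x1]; first by rewrite -frobenius_sqr x1 expr1n.
by apply/eqP; rewrite -(@eqrXn2 _ 2)// ?frobenius_ge0// frobenius_sqr x1 expr1n.
Qed.

End Frobenius.

(** * One round of rank-1 DMD on a perturbed matrix *)

(** One direction step in scalars: [a] and [b] are the sizes of the components of [x] along and
    across [u], and [p] is the shift of the power iteration. Up to noise, the transverse part is
    multiplied by at most [p + eta * lam / 2] and the aligned part by [p + eta * lam]; this gap pays
    both for the noise [e] and for the rate [eta * lam / 10]. *)
Lemma tangent_contraction {R : realType} (p eta lam e tau tau0 s a b : R) :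
  0 <= p <= 3 / 2 -> 0 < eta <= 1 / 4 -> 0 < lam <= 1 -> 0 <= e -> 1 <= tau0 ->
  e * (1 + tau0) <= lam / 8 -> lam * s = 5 * e -> s <= tau <= tau0 ->
  0 <= tau -> 0 <= a -> b <= tau * a -> 1 <= a + b ->
  p * b + eta * (lam / 2 * b + e)
    <= (tau - eta * lam / 10 * (tau - s)) * ((p + eta * lam) * a - eta * e).
Proof.
move=> /andP[p0 p1] /andP[eta0 eta1] /andP[lam0 lam1] e0 t1 et sE.
move=> /andP[st tt0] t0 a0 ba ab.
(* Since [1 <= a + b <= (1 + tau) * a], the additive noise becomes relative to [a]. *)
have ea : e <= e * (1 + tau) * a.
  by rewrite -mulrA ler_peMr//; nra.
have ea8 : e * (1 + tau) * a <= lam / 8 * a.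
  by rewrite ler_wpM2r// (le_trans _ et)// ler_wpM2l// lerD2l.
set q := eta * lam; have q0 : 0 < q by rewrite mulr_gt0.
have q1 : q <= 1 / 4 by rewrite /q; nra.
have eq8 : eta * e <= q / 8 * a.
  by rewrite /q -!mulrA ler_wpM2l ?(ltW eta0)// mulrA (le_trans ea).
have tau'0 : 0 <= tau - q / 10 * (tau - s).
  have : 0 <= s by rewrite -(pmulr_rge0 _ lam0) sE mulr_ge0.
  nra.
apply: (@le_trans _ _ (((p + q / 2) * tau + eta * (e * (1 + tau))) * a)).
  have -> : p * b + eta * (lam / 2 * b + e) = (p + q / 2) * b + eta * e by rewrite /q; ring.
  rewrite [leRHS]mulrDl lerD//.
    by rewrite -mulrA ler_wpM2l//; lra.
  by rewrite -(mulrA eta) ler_wpM2l// ltW.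
apply: (@le_trans _ _ ((tau - q / 10 * (tau - s)) * ((p + 7 / 8 * q) * a))); last first.
  by rewrite ler_wpM2l//; lra.
rewrite [leRHS]mulrA ler_wpM2r//.
(* This fixes the 5 in [s]: once [p + 7 / 8 * q] is bounded by 2, the term [q / 5 * s] is exactly
   the remaining noise [eta * e]. *)
have qs : q * s = 5 * (eta * e) by rewrite /q -mulrA sE; ring.
have h : eta * (e * (1 + tau)) <= eta * e + q / 16 * tau.
  rewrite mulrDr mulr1 mulrDr lerD2l /q -!mulrA ler_wpM2l ?(ltW eta0)// mulrA.
  by rewrite ler_wpM2r//; nra.
have : q / 10 * (tau - s) * (p + 7 / 8 * q) <= q / 10 * (tau - s) * 2.
  rewrite ler_wpM2l//; last by lra.
  by rewrite mulr_ge0 ?subr_ge0//; lra.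
have : 0 <= q * tau by rewrite mulr_ge0// ltW.
rewrite mulrDl !mulrBl !mulrDr; set X := (p * tau); nra.
Qed.

Section RankOne.
Context {R : realType} {m : nat}.
Variables (M E : 'M[R]_m) (u : 'cV[R]_m) (lam e : R).
Hypotheses (MT : M^T = M) (Mu : M *m u = lam *: u) (u1 : frobenius u = 1).
Hypothesis lam01 : 0 < lam <= 1.
Hypothesis M_ortho : forall v : 'cV[R]_m, inner u v = 0 ->
  frobenius (M *m v) <= lam / 2 * frobenius v.
Hypothesis E_le : frobenius E <= e.
Let B := M + E.

Definition orth (x : 'cV[R]_m) := x - inner u x *: u.

Lemma inner_unit_self : inner u u = 1.
Proof. exact/frobenius_unit. Qed.

Lemma inner_orth x : inner u (orth x) = 0.
Proof. by rewrite /orth innerDr innerNr innerZr inner_unit_self mulr1 subrr. Qed.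

Lemma orth_decomp x : x = inner u x *: u + orth x.
Proof. by rewrite /orth addrC subrK. Qed.

Lemma pythagoras x : frobenius x ^+ 2 = inner u x ^+ 2 + frobenius (orth x) ^+ 2.
Proof.
rewrite !frobenius_sqr; have := inner_orth x; have := orth_decomp x.
move: (orth x) (inner u x) => v a -> uv.
rewrite !(innerDl, innerDr, innerZl, innerZr) (innerC v) uv inner_unit_self; ring.
Qed.

Lemma frobenius_orth_le x : frobenius (orth x) <= frobenius x.
Proof.
rewrite -(@ler_pXn2r _ 2)// ?nnegrE ?frobenius_ge0// [leRHS]pythagoras.
by rewrite lerDr sqr_ge0.
Qed.

Lemma orth_add x y : orth (x + y) = orth x + orth y.
Proof. by rewrite /orth innerDr scalerDl opprD addrACA. Qed.

Lemma orth_scale a x : orth (a *: x) = a *: orth x.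
Proof. by rewrite /orth innerZr scalerBr scalerA. Qed.

Lemma inner_eigenvector_mul x : inner u (M *m x) = lam * inner u x.
Proof. by rewrite inner_sym_mulmx// Mu innerZl. Qed.

Lemma orth_mul x : orth (M *m x) = M *m orth x.
Proof. by rewrite /orth inner_eigenvector_mul mulmxBr -scalemxAr Mu scalerA (mulrC lam). Qed.

Lemma perturbation_ge0 : 0 <= e.
Proof. exact: le_trans (frobenius_ge0 _) E_le. Qed.

Section Unit.
Variable x : 'cV[R]_m.
Hypothesis x1 : frobenius x = 1.

Lemma perturbation_mul_le : frobenius (E *m x) <= e.
Proof. by rewrite (le_trans (frobeniusM _ _))// x1 mulr1. Qed.

Lemma inner_unit_le1 : `|inner u x| <= 1.
Proof. by rewrite (le_trans (cauchy_schwarz _ _))// u1 x1 mulr1. Qed.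

Lemma orth_unit_le1 : frobenius (orth x) <= 1.
Proof. by rewrite -x1 frobenius_orth_le. Qed.

Lemma sqr_inner_orth : inner u x ^+ 2 = 1 - frobenius (orth x) ^+ 2.
Proof. by apply/eqP; rewrite eq_sym subr_eq -pythagoras x1 expr1n. Qed.

(** As [u] is an eigenvector there is no cross term, and the unperturbed difference is quadratic in
    [orth x]; it is weakened to a linear bound because [orth x] has norm at most 1. *)
Lemma rayleigh_near : `|rayleigh B x - lam| <= 2 * lam * frobenius (orth x) + e.
Proof.
have -> : rayleigh B x - lam
    = (inner (orth x) (M *m orth x) - lam * frobenius (orth x) ^+ 2) + inner x (E *m x).
  have -> : frobenius (orth x) ^+ 2 = 1 - inner u x ^+ 2 by rewrite sqr_inner_orth; ring.
  rewrite rayleighE mulmxDl innerDr addrAC; congr (_ + _).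
  have := inner_orth x; have := inner_eigenvector_mul (orth x); have := orth_decomp x.
  move: (orth x) (inner u x) => v a -> uMv uv; rewrite uv mulr0 in uMv.
  rewrite mulmxDr -scalemxAr Mu !(innerDl, innerDr, innerZl, innerZr).
  rewrite (innerC v) uv uMv inner_unit_self; ring.
have h1 : `|inner x (E *m x)| <= e.
  by rewrite (le_trans (cauchy_schwarz _ _))// x1 mul1r perturbation_mul_le.
have h2 : `|inner (orth x) (M *m orth x)| <= lam / 2 * frobenius (orth x).
  rewrite (le_trans (cauchy_schwarz _ _))//.
  rewrite (le_trans (ler_wpM2l (frobenius_ge0 _) (M_ortho _ (inner_orth x))))//.
  by rewrite ler_piMl ?orth_unit_le1// mulr_ge0 ?frobenius_ge0// divr_ge0// ltW//; case/andP: lam01.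
have h3 : lam * frobenius (orth x) ^+ 2 <= lam * frobenius (orth x).
  by rewrite ler_wpM2l ?expr2 ?ler_piMl ?frobenius_ge0 ?orth_unit_le1// ltW//; case/andP: lam01.
rewrite (le_trans (ler_normD _ _))// lerD//.
rewrite (le_trans (ler_normB _ _))//.
rewrite (ger0_norm (x := lam * _)); last first.
  by rewrite mulr_ge0 ?sqr_ge0// ltW//; case/andP: lam01.
have : 0 <= lam * frobenius (orth x).
  by rewrite mulr_ge0 ?frobenius_ge0// ltW//; case/andP: lam01.
lra.
Qed.

(** Comparing [u] with [inner u x *: x] instead of [x] makes the sign of [x] irrelevant; this
    difference has the same norm as [orth x]. *)
Lemma outer_near : frobenius (x *m x^T - u *m u^T) <= 2 * frobenius (orth x).
Proof.
have -> : x *m x^T - u *m u^T = orth x *m x^T + u *m (inner u x *: x - u)^T.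
  have -> : (inner u x *: x - u)^T = inner u x *: x^T - u^T.
    by rewrite linearB/= linearZ.
  rewrite /orth mulmxBl -scalemxAl.
  by rewrite mulmxBr -scalemxAr addrA subrK.
have h : frobenius (inner u x *: x - u) = frobenius (orth x).
  apply/eqP; rewrite -(@eqrXn2 _ 2)// ?frobenius_ge0//; apply/eqP.
  rewrite frobenius_sqr !(innerDl, innerDr, innerNl, innerNr, innerZl, innerZr).
  rewrite (innerC x u) inner_unit_self -(frobenius_sqr x) x1.
  have -> : frobenius (orth x) ^+ 2 = 1 - inner u x ^+ 2 by rewrite sqr_inner_orth; ring.
  ring.
rewrite (le_trans (frobeniusD _ _))// mulr2n mulrDl mul1r lerD//.
  by rewrite (le_trans (frobeniusM _ _))// frobeniusT x1 mulr1.
by rewrite (le_trans (frobeniusM _ _))// frobeniusT u1 mul1r h.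
Qed.

(** Three errors add up: the perturbation [E], the error of the magnitude, and the error of the
    direction scaled by [lam]. *)
Lemma deflation_le :
  frobenius (B - rayleigh B x *: (x *m x^T) - (M - lam *: (u *m u^T)))
    <= 2 * e + 4 * lam * frobenius (orth x).
Proof.
have -> : B - rayleigh B x *: (x *m x^T) - (M - lam *: (u *m u^T))
    = E - ((rayleigh B x - lam) *: (x *m x^T) + lam *: (x *m x^T - u *m u^T)).
  rewrite /B; move: (x *m x^T) (u *m u^T) => X Y.
  by apply/matrixP => i j; rewrite !mxE; ring.
rewrite (le_trans (frobeniusD _ _))// frobeniusN.
have xx1 : frobenius (x *m x^T) <= 1.
  by rewrite (le_trans (frobeniusM _ _))// frobeniusT x1 mulr1.
have h1 : frobenius ((rayleigh B x - lam) *: (x *m x^T))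
    <= 2 * lam * frobenius (orth x) + e.
  rewrite frobeniusZ (le_trans _ rayleigh_near)//.
  by rewrite -[leRHS]mulr1 ler_wpM2l.
have h2 : frobenius (lam *: (x *m x^T - u *m u^T)) <= 2 * lam * frobenius (orth x).
  case/andP: lam01 => l0 _; rewrite frobeniusZ gtr0_norm//.
  by have := outer_near; move: (frobenius _) (frobenius (orth x)) => F b; nra.
have := frobeniusD ((rayleigh B x - lam) *: (x *m x^T)) (lam *: (x *m x^T - u *m u^T)).
have := E_le; lra.
Qed.

End Unit.

(** * Contraction of the tangent along the iterations *)

Section Iteration.
Variables (eta tau0 : R).
Hypotheses (eta0 : 0 < eta <= 1 / 4) (tau0_ge1 : 1 <= tau0)
  (e_small : e * (1 + tau0) <= lam / 8).
(* The tangent left in the limit by a perturbation of norm [e]. *)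
Let s := 5 * e / lam.
Let rho := eta * lam / 10.

Lemma perturbation_le : e <= lam / 16.
Proof.
have h : e * 2 <= e * (1 + tau0) by rewrite ler_wpM2l ?perturbation_ge0//; have := tau0_ge1; lra.
by have := le_trans h e_small; lra.
Qed.

Lemma limit_tangent_le : s <= tau0.
Proof.
case/andP: lam01 => l0 _; rewrite /s ler_pdivrMr//.
have e16 := perturbation_le.
by rewrite (le_trans (_ : _ <= lam))//; [lra | by rewrite ler_peMl// ltW].
Qed.

Lemma contraction_rate01 : 0 <= rho <= 1.
Proof. by rewrite /rho; case/andP: lam01 => *; case/andP: eta0 => *; apply/andP; split; nra. Qed.

(** The increment is orthogonal to [x], so [inner x y = 1]; hence [y] is nonzero and can be
    normalised. *)
Lemma direction_step_unit x : frobenius x = 1 ->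
  frobenius (direction_step B eta x) = 1.
Proof.
move=> x1; rewrite /direction_step euclidE; set y := x + _.
rewrite frobeniusZ ger0_norm ?invr_ge0 ?frobenius_ge0// mulVf//.
apply/eqP => /frobenius_eq0 y0.
have : inner x y = 1.
  rewrite /y innerDr innerZr -mulmxA mulmxBl mul1mx outer_mul innerDr innerNr.
  by rewrite innerZr (frobenius_unit x).1//; ring.
by rewrite y0 /inner mulmx0 mxtrace0 => /eqP; rewrite eq_sym oner_eq0.
Qed.

(** Normalisation scales both components alike, so it suffices to treat
    [y = p *: x + eta *: (M *m x + E *m x)] and apply [tangent_contraction]. *)
Lemma direction_step_tangent x tau : frobenius x = 1 -> s <= tau <= tau0 ->
  frobenius (orth x) <= tau * `|inner u x| ->
  frobenius (orth (direction_step B eta x))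
    <= (tau - rho * (tau - s)) * `|inner u (direction_step B eta x)|.
Proof.
move=> x1 /andP[s_tau tau_tau0] h.
rewrite /direction_step; set y := x + _.
rewrite orth_scale innerZr normrM frobeniusZ mulrCA ler_wpM2l//.
set th := rayleigh B x; set b := frobenius (orth x); set A := `|inner u x|.
set p := 1 - eta * th.
case/andP: (lam01) => l0 l1; case/andP: (eta0) => et0 et1.
have e0 := perturbation_ge0.
have e16 := perturbation_le.
have b0 : 0 <= b := frobenius_ge0 _.
have b1 : b <= 1 := orth_unit_le1 _ x1.
have A1 : 1 <= A + b.
  rewrite -x1 [in leLHS](orth_decomp x) (le_trans (frobeniusD _ _))//.
  by rewrite frobeniusZ u1 mulr1.
(* With [eta <= 1 / 4], this range of the Rayleigh quotient keeps the shift [p] between 0 and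
   3/2. *)
have th_le : - (3 / 2) <= th <= 4.
  have := rayleigh_near _ x1; rewrite -/th ler_norml.
  rewrite -/b.
  have : lam * b <= 1 by nra.
  have : 0 <= lam * b by nra.
  have : lam * b <= lam by nra.
  by move=> ? ? ? /andP[? ?]; apply/andP; split; lra.
have {th_le} [p0 p2] : 0 <= p /\ p <= 3 / 2.
  by move: th_le; rewrite /p => /andP[? ?]; split; nra.
have yE : y = p *: x + eta *: (M *m x + E *m x).
  rewrite /y -mulmxDl -/B -[in LHS]mulmxA mulmxBl mul1mx outer_mul -rayleighE -/th.
  by rewrite scalerBr scalerA /p scalerBl scale1r addrA addrAC.
have orthy : frobenius (orth y) <= p * b + eta * (lam / 2 * b + e).
  rewrite yE orth_add !orth_scale orth_add orth_mul (le_trans (frobeniusD _ _))//.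
  rewrite !frobeniusZ !ger0_norm ?(ltW et0)// lerD2l ler_wpM2l ?(ltW et0)//.
  rewrite (le_trans (frobeniusD _ _))// lerD ?M_ortho ?inner_orth//.
  by rewrite (le_trans (frobenius_orth_le _))// perturbation_mul_le.
have innery : (p + eta * lam) * A - eta * e <= `|inner u y|.
  have -> : inner u y = (p + eta * lam) * inner u x + eta * inner u (E *m x).
    by rewrite yE innerDr !innerZr innerDr inner_eigenvector_mul; ring.
  rewrite (le_trans _ (lerB_normD _ _))// !normrM (ger0_norm (ltW et0)).
  rewrite (ger0_norm (x := p + _)); last by move: (mulr_gt0 et0 l0) p0; lra.
  rewrite lerB// ler_wpM2l ?(ltW et0)// (le_trans (cauchy_schwarz _ _))// u1 mul1r.
  exact: perturbation_mul_le.
have tau_ge0 : 0 <= tau by rewrite (le_trans _ s_tau)// /s divr_ge0 ?mulr_ge0 ?(ltW l0).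
apply: le_trans orthy _.
apply: (@le_trans _ _ ((tau - rho * (tau - s)) * ((p + eta * lam) * A - eta * e))).
  apply: (@tangent_contraction _ _ _ _ _ _ tau0); rewrite ?p0 ?p2 ?s_tau ?normr_ge0//.
  by rewrite /s mulrC divfK// gt_eqF.
rewrite ler_wpM2l// subr_ge0; case/andP: contraction_rate01 => r0 r1.
rewrite (le_trans (ler_wpM2r _ r1)) ?subr_ge0// mul1r gerBl.
by rewrite /s divr_ge0 ?mulr_ge0 ?(ltW l0).
Qed.

(** [s] is the fixed point of the one-step bound, so the excess over [s] shrinks by the factor
    [1 - rho] per step. *)
Lemma rank1_dmd_tangent x T : frobenius x = 1 ->
  frobenius (orth x) <= tau0 * `|inner u x| ->
  let xT := (rank1_dmd x B eta 2 T).1 in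
  frobenius xT = 1 /\ frobenius (orth xT) <= (s + (1 - rho) ^+ T * (tau0 - s)) * `|inner u xT|.
Proof.
move=> x1 h; elim: T => [|T [IH1 IH2]] /=.
  by rewrite expr0 mul1r addrC subrK.
split; first exact: direction_step_unit.
case/andP: contraction_rate01 => r0 r1; have st := limit_tangent_le.
have pw : 0 <= (1 - rho) ^+ T <= 1 by rewrite exprn_ge0 ?exprn_ile1 ?subr_ge0// gerBl.
have := direction_step_tangent _ _ IH1 _ IH2.
set X := (1 - rho) ^+ T in pw *.
rewrite exprS (_ : _ - rho * _ = s + (1 - rho) * X * (tau0 - s)); last by ring.
apply; case/andP: pw => pw0 pw1.
rewrite lerDl mulr_ge0 ?subr_ge0//=.
by rewrite -lerBrDl ler_piMl// subr_ge0.
Qed.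

(** For [mu = 2] the previous magnitude cancels, including the conventional 0 that precedes the
    first one. *)
Lemma rank1_dmd_rayleigh x (C : 'M[R]_m) T :
  (rank1_dmd x C eta 2 T).2 = rayleigh C (rank1_dmd x C eta 2 T).1.
Proof.
by case: T => [|T] /=; rewrite /magnitude_step divff ?pnatr_eq0// mul1r opprB addrC subrK.
Qed.

(** An overlap of at least [1 / tau0] bounds the initial tangent by [tau0]. In [deflation_le] the
    limit tangent contributes [4 * lam * s = 20 * e], which with [2 * e] gives 22. *)
Lemma rank1_dmd_deflation x T : frobenius x = 1 -> 1 <= tau0 * `|inner u x| ->
  frobenius (B - rank1_of (rank1_dmd x B eta 2 T) - (M - lam *: (u *m u^T)))
    <= 22 * e + 4 * ((1 - eta * lam / 10) ^+ T * tau0).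
Proof.
move=> x1 h; have h' := le_trans (orth_unit_le1 _ x1) h.
have [xT1] := rank1_dmd_tangent _ T x1 h'.
rewrite /rank1_of rank1_dmd_rayleigh; move: (rank1_dmd _ _ _ _ _).1 xT1 => xT xT1 tanT.
rewrite (le_trans (deflation_le _ xT1))//.
case/andP: (lam01) => l0 l1; case/andP: contraction_rate01 => r0 r1.
have s0 : 0 <= s by rewrite divr_ge0 ?(ltW l0)// mulr_ge0// perturbation_ge0.
have Y0 : 0 <= (1 - rho) ^+ T by rewrite exprn_ge0// subr_ge0.
have bT : frobenius (orth xT) <= s + (1 - rho) ^+ T * tau0.
  apply: le_trans tanT _; apply: (@le_trans _ _ (s + (1 - rho) ^+ T * (tau0 - s))).
    rewrite ler_piMr ?inner_unit_le1// addr_ge0// mulr_ge0// subr_ge0; exact: limit_tangent_le.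
  by rewrite lerD2l ler_wpM2l// gerBl.
have -> : 22 * e = 2 * e + 4 * lam * s.
  have -> : 4 * lam * s = 4 * (s * lam) by ring.
  by rewrite /s divfK ?gt_eqF//; ring.
rewrite -addrA lerD2l (le_trans (ler_wpM2l _ bT)) ?mulr_ge0 ?(ltW l0)//.
rewrite mulrDr lerD2l -(mulrA 4) ler_wpM2l// ler_piMl//.
by rewrite mulr_ge0// (le_trans _ tau0_ge1).
Qed.

End Iteration.
End RankOne.

(** * Successive deflations *)

Section Rounds.
Context {R : realType} {m rA T : nat}.
Variables (M : nat -> 'M[R]_m) (u : nat -> 'cV[R]_m) (lam : nat -> R).
Variables (kappa eps eta delta xi : R).
Hypotheses (MT : forall j, (j < rA)%N -> (M j)^T = M j)
  (Mu : forall j, (j < rA)%N -> M j *m u j = lam j *: u j)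
  (u1 : forall j, (j < rA)%N -> frobenius (u j) = 1)
  (lam_ge : forall j, (j < rA)%N -> 1 / kappa <= lam j <= 1)
  (M_ortho : forall j, (j < rA)%N -> forall v, inner (u j) v = 0 ->
     frobenius (M j *m v) <= lam j / 2 * frobenius v)
  (MS : forall j, (j < rA)%N -> M j.+1 = M j - lam j *: (u j *m (u j)^T))
  (M_last : M rA = 0).
Hypotheses (kappa1 : 1 < kappa) (eps01 : 0 < eps <= 1 / kappa)
  (eta01 : 0 < eta <= 1 / 4) (delta01 : 0 < delta <= 1).
Hypotheses (xi_ge : (1 - eta * (1 / kappa) / 10) ^+ T / delta <= xi)
  (xi_small : xi * 32 ^+ rA <= delta * eps / 16).

Lemma inv_condition01 : 0 < 1 / kappa <= 1.
Proof.
have k0 := lt_trans ltr01 kappa1.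
by rewrite divr_gt0//= ler_pdivrMr// mul1r ltW.
Qed.

Lemma round_budget_ge0 : 0 <= xi.
Proof.
case/andP: eta01 => e0 e1; case/andP: delta01 => d0 d1.
rewrite (le_trans _ xi_ge)// divr_ge0 ?(ltW d0)// exprn_ge0//.
by case/andP: inv_condition01 => *; nra.
Qed.

Lemma round_error j : (j <= rA)%N -> xi * (32 ^+ j - 1) <= delta * eps / 16.
Proof.
move=> jr; rewrite (le_trans _ xi_small)// ler_wpM2l ?round_budget_ge0//.
by rewrite (le_trans (y := 32 ^+ j)) ?gerBl// ler_weXn2l// ler1n.
Qed.

(** The bound [xi * (32 ^+ j - 1)] is 0 before the first round, where the matrix is exact, and
    dominates the recursion [e -> 22 * e + 4 * xi] of [rank1_dmd_deflation] with
    [tau0 = delta^-1]. *)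
Lemma round_deflation j B x : (j < rA)%N ->
  frobenius (B - M j) <= xi * (32 ^+ j - 1) -> frobenius x = 1 ->
  delta <= `|inner (u j) x| ->
  frobenius (B - rank1_of (rank1_dmd x B eta 2 T) - M j.+1)
    <= xi * (32 ^+ j.+1 - 1).
Proof.
move=> jr; set e := xi * (32 ^+ j - 1) => Be x1 ov.
case/andP: (eta01) => e0 e1; case/andP: (delta01) => d0 d1.
case/andP: (lam_ge _ jr) => l0 l1; case/andP: (eps01) => p0 p1.
have /andP[ik ik1] := inv_condition01.
have lam01 : 0 < lam j <= 1 by rewrite (lt_le_trans ik).
(* From [e <= delta * eps / 16] and [1 + delta^-1 <= 2 * delta^-1] the product is at most [eps / 8],
   and [eps <= 1 / kappa <= lam j]. *)
have e_small : e * (1 + delta^-1) <= lam j / 8.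
  have h : e <= delta * (eps / 16) by rewrite mulrA; exact: round_error (ltnW jr).
  have dV : 1 + delta^-1 <= 2 * delta^-1.
    by rewrite mulr2n mulrDl mul1r lerD2r invf_ge1.
  have e_ge0 : 0 <= e by exact: le_trans (frobenius_ge0 _) Be.
  apply: le_trans (ler_wpM2l e_ge0 dV) _.
  apply: (@le_trans _ _ (delta * (eps / 16) * (2 * delta^-1))).
    by rewrite ler_wpM2r// mulr_ge0// invr_ge0 ltW.
  rewrite (_ : _ * _ = eps / 8); last by field; rewrite gt_eqF.
  by rewrite ler_wpM2r// (le_trans p1).
have tau1 : 1 <= delta^-1 by rewrite invf_ge1.
have ov' : 1 <= delta^-1 * `|inner (u j) x|.
  by rewrite mulrC ler_pdivlMr// mul1r.
have := @rank1_dmd_deflation _ _ (M j) (B - M j) (u j) (lam j) e (MT _ jr)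
  (Mu _ jr) (u1 _ jr) lam01 (M_ortho _ jr) Be eta delta^-1 eta01 tau1 e_small
  x T x1 ov'.
rewrite (addrC (M j)) subrK -MS// => /le_trans; apply.
(* The slowest contraction is the one for the smallest eigenvalue [1 / kappa]. *)
have xi'_le : (1 - eta * lam j / 10) ^+ T * delta^-1 <= xi.
  rewrite (le_trans _ xi_ge)// ler_wpM2r ?invr_ge0 ?(ltW d0)//.
  have ? : eta * (1 / kappa) <= eta * lam j by rewrite ler_wpM2l// ltW.
  have ? : eta * lam j <= 1 by nra.
  have ? : 0 <= eta * (1 / kappa) by rewrite mulr_ge0 ?(ltW e0) ?(ltW ik).
  rewrite lerXn2r// ?nnegrE; lra.
have P0 : 0 <= xi * (32 ^+ j - 1) := le_trans (frobenius_ge0 _) Be.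
have := round_budget_ge0; rewrite /e exprS; move: (32 ^+ j) P0 => P P0 X0; nra.
Qed.

(** Induction on the rounds left. The outputs minus [B] give minus the final residual, so an early
    stop yields the claim by the stopping test itself; when one round is left, [M_last] makes the
    residual small enough to pass the test. *)
Lemma recursive_dmd_success k j B inits : (j + k.+1 = rA)%N ->
  frobenius (B - M j) <= xi * (32 ^+ j - 1) -> (k < size inits)%N ->
  (forall i, (i <= k)%N -> frobenius (nth 0 inits i) = 1 /\
     delta <= `|inner (u (j + i)) (nth 0 inits i)|) ->
  let out := recursive_dmd B eps eta 2 T inits in
  1 / 4 * frobenius (\sum_(o <- out) rank1_of o - B) ^+ 2 <= eps /\
  (size out <= k.+1)%N.
Proof.
elim: k j B inits => [|k IH] j B [|x inits] jr Be sz ov //=.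
all: have jlt : (j < rA)%N by rewrite -jr addnS ltnS leq_addr.
all: have [x1 xov] := ov 0%N isT; rewrite /= addn0 in x1 xov.
all: have := round_deflation _ _ _ jlt Be x1 xov.
all: move: (rank1_dmd _ _ _ _ _) => o; set B' := B - _ => Be'.
  have Bo : 1 / 4 * frobenius B' ^+ 2 <= eps.
    case/andP: (eps01) => p0 p1; case/andP: (delta01) => d0 d1.
    move: Be'; rewrite -[j.+1]addn1 jr M_last subr0.
    move=> /le_trans/(_ (round_error _ (leqnn _))) h.
    have /andP[_ k1] := inv_condition01.
    have : frobenius B' <= eps / 16.
      by rewrite (le_trans h)// -mulrA ler_piMl// divr_ge0// ltW.
    have := frobenius_ge0 B'; move: (frobenius _) => F F0 F1.
    nra.
  by rewrite Bo big_cons big_nil addr0 -opprB frobeniusN.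
case: ifPn => [Bo|_]; first by rewrite big_cons big_nil addr0 -opprB frobeniusN.
have [] := IH j.+1 B' inits; rewrite ?addSnnS//.
  by move=> i ik; have := ov i.+1 ik; rewrite addnS.
move=> h1 h2; split=> //; rewrite big_cons; move: h1; rewrite /B'.
by rewrite opprB addrCA addrA.
Qed.

End Rounds.

(** * Spectral decomposition and singular values *)

Section Householder.
Context {R : realType}.

(** For [u] and [v] distinct, the Householder reflection in the hyperplane orthogonal to [u - v]
    works, because [inner w w = 2 * inner w u]. *)
Lemma orthogonal_transitive {m} (u v : 'cV[R]_m) :
  frobenius u = 1 -> frobenius v = 1 ->
  exists2 Q : 'M[R]_m, Q^T *m Q = 1%:M & Q *m u = v.
Proof.
move=> /frobenius_unit u1 /frobenius_unit v1.
have [<-|uv] := eqVneq u v.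
  by exists 1%:M; rewrite ?trmx1 ?mul1mx.
pose w := u - v; have w0 : inner w w != 0.
  rewrite -frobenius_sqr sqrf_eq0; apply: contra_neq uv => /frobenius_eq0 /eqP.
  by rewrite subr_eq0 => /eqP.
have wwE : inner w w = 2 * inner w u.
  rewrite /w !(innerDl, innerDr, innerNl, innerNr) u1 v1 (innerC u v); ring.
pose c := 2 / inner w w; pose Q : 'M[R]_m := 1%:M - c *: (w *m w^T).
have QT : Q^T = Q by rewrite /Q linearB/= trmx1 linearZ/= trmx_mul trmxK.
exists Q.
  have WW : (w *m w^T) *m (w *m w^T) = inner w w *: (w *m w^T).
    by rewrite mulmxA outer_mul -scalemxAl.
  rewrite QT /Q /c; move: (w *m w^T) (inner w w) w0 WW => W n n0 WW.
  rewrite mulmxBr mulmx1 [X in _ - X]mulmxBl mul1mx -scalemxAl -scalemxAr WW.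
  by apply/matrixP => i j; rewrite !mxE; field.
rewrite /Q mulmxBl mul1mx -scalemxAl outer_mul scalerA /c wwE.
have wu0 : inner w u != 0 by apply: contra_neq w0; rewrite wwE => ->; rewrite mulr0.
have -> : 2 / (2 * inner w u) * inner w u = 1 by field.
by rewrite scale1r /w opprB addrC subrK.
Qed.

End Householder.

Section Spectral.
Context {R : realType}.

(** Over the complex extension [A] is Hermitian, hence unitarily diagonalizable with real spectrum.
    A real eigenvalue is a root of the characteristic polynomial, which has coefficients in [R], so
    it has an eigenvector over [R]. *)
Lemma symmetric_eigenvector {n} (A : 'M[R]_n.+1) : A^T = A ->
  exists a (x : 'cV[R]_n.+1), frobenius x = 1 /\ A *m x = a *: x.
Proof.
move=> AT; pose toC := real_complex R; pose Ac := map_mx toC A.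
have Ah : Ac \is hermsymmx.
  apply: realsym_hermsym; last first.
    by apply/mxOverP => i j; rewrite mxE; apply/complex_realP; exists (A i j).
  by apply/is_hermitianmxP; rewrite expr0 scale1r map_mx_id// /Ac map_trmx AT.
have /complex_realP[a aE] := mxOverP (hermitian_spectral_diag_real Ah) 0 0.
have /hermitian_normalmx/orthomx_spectralP := Ah.
set P := spectralmx Ac; set D := spectral_diag Ac in aE * => AcE.
have Pu : P \in unitmx by exact: spectral_unit.
have : eigenvalue Ac (toC a).
  apply/eigenvalueP; exists (row 0 P); last first.
    apply/negP => /eqP P0; have := mulmxV Pu.
    move=> /(congr1 (row 0)); rewrite row_mul P0 mul0mx => /rowP/(_ 0).
    by rewrite !mxE eqxx => /eqP; rewrite eq_sym oner_eq0.
  rewrite -row_mul AcE !mulmxA mulmxV// mul1mx row_mul.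
  by apply/rowP => j; rewrite row_diag_mx -scalemxAl -rowE !mxE aE.
rewrite eigenvalue_root_char -map_char_poly fmorph_root -eigenvalue_root_char.
move=> /eigenvalueP[v vA v0].
have f0 : frobenius v^T != 0.
  by apply: contra_neq v0 => /frobenius_eq0 h; rewrite -[v]trmxK h trmx0.
exists a, ((frobenius v^T)^-1 *: v^T); split.
  by rewrite frobeniusZ ger0_norm ?mulVf// invr_ge0 frobenius_ge0.
by rewrite -scalemxAr -{1}AT -trmx_mul vA linearZ/= scalerA mulrC -scalerA.
Qed.

(** Induction on the size: an orthogonal matrix moves a unit eigenvector to the first basis vector,
    after which symmetry leaves a block diagonal matrix with a smaller symmetric block. *)
Lemma symmetric_spectral {n} (A : 'M[R]_n) : A^T = A ->
  exists (Q : 'M[R]_n) (d : 'rV[R]_n),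
    Q^T *m Q = 1%:M /\ A = Q^T *m diag_mx d *m Q.
Proof.
elim: n A => [|n IH] A AT.
  by exists 1%:M, 0; split; apply/matrixP => -[].
have [a [x [x1 Ax]]] := symmetric_eigenvector A AT.
pose e : 'cV[R]_(1 + n) := col_mx 1%:M 0.
have e1 : frobenius e = 1.
  apply/frobenius_unit; rewrite /inner tr_col_mx mul_row_col trmx1 mul1mx.
  by rewrite mulmx0 addr0 mxtrace1.
have [H HH Hx] := orthogonal_transitive x e x1 e1.
have HH' := mulmx1C HH.
pose B := H *m A *m H^T.
have BT : B^T = B by rewrite /B !trmx_mul trmxK AT mulmxA.
have xE : x = H^T *m e by rewrite -Hx mulmxA HH mul1mx.
have Be : B *m e = a *: e.
  by rewrite /B -mulmxA -xE -mulmxA Ax -scalemxAr Hx.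
pose B' : 'M[R]_(1 + n) := B.
have [ul dl] : ulsubmx B' = a%:M /\ dlsubmx B' = 0.
  suff /eq_col_mx[] : col_mx (ulsubmx B') (dlsubmx B') = col_mx a%:M 0 by [].
  have : B' *m e = a *: e := Be.
  rewrite -{1}[B']submxK /e mul_block_col !mulmx1 !mulmx0 !addr0 => ->.
  by rewrite scale_col_mx scaler0 scalemx1.
have ur : ursubmx B' = 0 by rewrite -[B']BT -trmx_dlsub dl trmx0.
have drT : (drsubmx B')^T = drsubmx B' by rewrite trmx_drsub [B'^T]BT.
have [Q [d [QQ BE]]] := IH _ drT.
pose Q' : 'M[R]_(1 + n) := block_mx 1%:M 0 0 Q.
have Q'T : Q'^T = block_mx 1%:M 0 0 Q^T by rewrite /Q' tr_block_mx trmx1 !trmx0.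
have Q'Q' : Q'^T *m Q' = 1%:M.
  rewrite Q'T /Q' mulmx_block !mulmx0 !mul0mx !mulmx1 !add0r !addr0 QQ.
  by rewrite -scalar_mx_block.
have B'E : B' = Q'^T *m diag_mx (row_mx a%:M d) *m Q'.
  rewrite -[LHS]submxK ul dl ur BE Q'T diag_mx_row /Q' !mulmx_block.
  rewrite !mulmx0 !mul0mx !mulmx1 !mul1mx !add0r !addr0 !mul0mx.
  by congr block_mx; apply/matrixP => i j; rewrite !ord1 !mxE eqxx.
exists (Q' *m H), (row_mx a%:M d); split.
  by rewrite trmx_mul mulmxA -(mulmxA H^T) Q'Q' mulmx1.
have -> : A = H^T *m B *m H.
  by rewrite /B !mulmxA HH mul1mx -mulmxA HH mulmx1.
by rewrite -[B]/B' B'E trmx_mul !mulmxA.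
Qed.

End Spectral.

(** * Singular values of positive semidefinite matrices *)

Section SingularValues.
Context {R : realType}.

Lemma char_poly_orthogonal_conj {n} (Q D : 'M[R]_n) : Q^T *m Q = 1%:M ->
  char_poly (Q^T *m D *m Q) = char_poly D.
Proof.
move=> QQ; rewrite /char_poly /char_poly_mx.
have -> : 'X%:M - map_mx polyC (Q^T *m D *m Q) =
    map_mx polyC Q^T *m ('X%:M - map_mx polyC D) *m map_mx polyC Q.
  rewrite mulmxBr mulmxBl -!map_mxM; congr (_ - _).
  by rewrite mul_mx_scalar -scalemxAl -map_mxM QQ map_mx1 scalemx1.
rewrite !det_mulmx mulrAC -det_mulmx -map_mxM QQ map_mx1 det1 mul1r//.
Qed.

Lemma char_poly_diag_mx {n} (d : 'rV[R]_n) :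
  char_poly (diag_mx d) = \prod_(a <- [seq d 0 i | i <- enum 'I_n]) ('X - a%:P).
Proof.
rewrite char_poly_trig ?diag_mx_is_trig// big_map enumT.
by apply: eq_bigr => i _; rewrite mxE eqxx.
Qed.

(** Each number occurs in both lists as often as its multiplicity as a root of the characteristic
    polynomial. *)
Lemma eigenvalues_perm {n} (A : 'M[R]_n) (s : seq R) :
  char_poly A = \prod_(a <- s) ('X - a%:P) -> perm_eq (eigenvalues A) s.
Proof.
move=> pE; apply/allP => x _ /=; rewrite -[X in _ == X]mu_prod_XsubC -pE.
have p0 : char_poly A != 0 by rewrite monic_neq0// char_poly_monic.
rewrite /eigenvalues count_flatten -!map_comp sumnE big_map.
under eq_bigr do rewrite /= count_nseq /=.
have [xr|xr] := boolP (x \in rootsR (char_poly A)); last first.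
  rewrite big1_seq ?mupNroot//.
    by apply: contra xr => xr; rewrite -roots_on_rootsR// xr.
  by move=> y /= yr; case: eqP yr xr => [-> ->|].
rewrite (bigD1_seq x) ?uniq_roots//= eqxx mul1n big1 ?addn0// => y.
by move=> /negPf->; rewrite mul0n.
Qed.

Lemma singular_values_sorted {m n} (A : 'M[R]_(m, n)) :
  sorted >=%R (singular_values A).
Proof. by apply: sort_sorted; exact: ge_total. Qed.

(** [A^T *m A] has eigenvalues [d 0 i ^+ 2], and their square roots are the [d 0 i] themselves,
    which are nonnegative as values of the quadratic form of [A]. *)
Lemma psd_spectral {m} (A : 'M[R]_m) : psdmx A ->
  exists (Q : 'M[R]_m) (d : 'rV[R]_m), [/\ Q^T *m Q = 1%:M,
    A = Q^T *m diag_mx d *m Q &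
    perm_eq (singular_values A) [seq d 0 i | i <- enum 'I_m]].
Proof.
move=> [AT Age0]; have [Q [d [QQ AE]]] := symmetric_spectral A AT.
exists Q, d; split=> //; have QQ' := mulmx1C QQ.
have d_ge0 i : 0 <= d 0 i.
  have := Age0 (Q^T *m delta_mx i 0).
  rewrite AE trmx_mul trmxK !mulmxA -(mulmxA _ Q Q^T) QQ' mulmx1.
  rewrite -(mulmxA _ Q Q^T) QQ' mulmx1 trmx_delta -rowE -colE mxE mxE.
  by rewrite mxE eqxx.
have dd : diag_mx d *m diag_mx d = diag_mx (\row_i (d 0 i ^+ 2)).
  by rewrite mulmx_diag; congr diag_mx.
have : perm_eq (eigenvalues (A^T *m A)) [seq d 0 i ^+ 2 | i <- enum 'I_m].
  apply: eigenvalues_perm.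
  have -> : A^T *m A = Q^T *m diag_mx (\row_i (d 0 i ^+ 2)) *m Q.
    by rewrite AT AE !mulmxA -(mulmxA _ Q Q^T) QQ' mulmx1 -dd !mulmxA.
  rewrite char_poly_orthogonal_conj// char_poly_diag_mx; congr bigop.
  by apply: eq_map => i; rewrite mxE.
rewrite /singular_values perm_sort => /(perm_map Num.sqrt)/perm_trans; apply.
rewrite -map_comp (@eq_map _ _ _ (fun i => d 0 i))// => i /=.
by rewrite sqrtr_sqr ger0_norm.
Qed.

Lemma psd_singular_decomposition {m} (A : 'M[R]_m) : psdmx A ->
  exists u : nat -> 'cV[R]_m,
    (forall i j, (i < m)%N -> (j < m)%N -> inner (u i) (u j) = (i == j)%:R) /\
    A = \sum_(0 <= i < m) singular_value A i.+1 *: (u i *m (u i)^T).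
Proof.
move=> /psd_spectral[Q [d [QQ AE pm]]].
have QQ' := mulmx1C QQ.
have {pm} : perm_eq (singular_values A) [tuple d 0 i | i < m].
  by [].
move=> /tuple_permP[p sE].
(* The permutation [p] that sorts the spectrum also orders the eigenvectors; indices from [m] on get
   the zero vector. *)
exists (fun i => oapp (fun i : 'I_m => (row (p i) Q)^T) 0 (insub i)); split.
  move=> i j im jm; rewrite !insubT /=.
  rewrite /inner trmxK trace_mx11.
  have -> : (row (p (Sub i im)) Q *m (row (p (Sub j jm)) Q)^T) 0 0 =
      (Q *m Q^T) (p (Sub i im)) (p (Sub j jm)).
    by rewrite !mxE; apply: eq_bigr => k _; rewrite !mxE.
  by rewrite QQ' mxE (inj_eq perm_inj).
rewrite big_mkord {1}AE mul_mx_diag; apply/matrixP => a b; rewrite summxE mxE.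
rewrite (reindex_inj (@perm_inj _ p)) /=; apply: eq_bigr => i _.
rewrite valK /= /singular_value /= sE (nth_map i) ?size_enum_ord//.
by rewrite nth_ord_enum tnth_mktuple !mxE big_ord1 !mxE; ring.
Qed.

Lemma singular_value_ge0 {m n} (A : 'M[R]_(m, n)) i : 0 <= singular_value A i.
Proof.
rewrite /singular_value; have [ilt|ige] := ltnP i.-1 (size (singular_values A)).
  have := mem_nth 0 ilt; rewrite mem_sort => /mapP[x _ ->].
  exact: sqrtr_ge0.
by rewrite nth_default.
Qed.

(** Index 0 reads the same entry as index 1, and past the end the default 0 lies below every
    singular value, so all indices are covered. *)
Lemma singular_value_anti {m n} (A : 'M[R]_(m, n)) i j : (i <= j)%N ->
  singular_value A j <= singular_value A i.
Proof.
move=> ij; have pij : (i.-1 <= j.-1)%N by case: i j ij => [|i] [|j].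
have [jlt|jge] := ltnP j.-1 (size (singular_values A)); last first.
  by rewrite {1}/singular_value nth_default// singular_value_ge0.
apply: (sorted_leq_nth ge_trans ge_refl 0 (singular_values_sorted A)) => //.
by rewrite inE (leq_ltn_trans pij).
Qed.

(** * Orthonormal families *)

Section OrthonormalFamily.
Variables (m : nat) (u : nat -> 'cV[R]_m).
Hypothesis uu : forall i j, (i < m)%N -> (j < m)%N -> inner (u i) (u j) = (i == j)%:R.

Lemma inner_sumr {p q} (x : 'M[R]_(p, q)) (s : seq nat) (F : nat -> 'M[R]_(p, q)) :
  inner x (\sum_(i <- s) F i) = \sum_(i <- s) inner x (F i).
Proof.
elim: s => [|i s IH]; last by rewrite !big_cons innerDr IH.
by rewrite !big_nil /inner mulmx0 mxtrace0.
Qed.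

Lemma inner_orthonormal_sum a b (c : nat -> R) j : (b <= m)%N -> (a <= j < b)%N ->
  inner (u j) (\sum_(a <= i < b) c i *: u i) = c j.
Proof.
move=> bm jab; rewrite inner_sumr (bigD1_seq j) ?iota_uniq ?mem_index_iota//=.
have jm : (j < m)%N by case/andP: jab => _ /leq_trans; apply.
rewrite innerZr uu// eqxx mulr1 big_seq_cond big1 ?addr0// => i.
rewrite mem_index_iota => /andP[/andP[_ ib] ij].
by rewrite innerZr uu ?(leq_trans ib)// eq_sym (negPf ij) mulr0.
Qed.

Lemma frobenius_orthonormal_sum a b (c : nat -> R) : (b <= m)%N ->
  frobenius (\sum_(a <= i < b) c i *: u i) ^+ 2 = \sum_(a <= i < b) c i ^+ 2.
Proof.
move=> bm; rewrite frobenius_sqr {2}/index_iota inner_sumr.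
rewrite big_seq [RHS]big_seq; apply: eq_bigr => i.
rewrite mem_index_iota => iab.
by rewrite innerZr innerC inner_orthonormal_sum// expr2.
Qed.

(** The projection [w] satisfies [inner v w = inner w w], and [v - w] has nonnegative squared
    norm. *)
Lemma bessel a (v : 'cV[R]_m) :
  \sum_(a <= i < m) inner (u i) v ^+ 2 <= frobenius v ^+ 2.
Proof.
pose w := \sum_(a <= i < m) inner (u i) v *: u i.
have vw : inner v w = inner w w.
  rewrite {1 2}/w !inner_sumr big_seq [RHS]big_seq; apply: eq_bigr => i.
  rewrite mem_index_iota => iam.
  by rewrite !innerZr (innerC w) inner_orthonormal_sum// innerC.
rewrite -frobenius_orthonormal_sum// -/w.
have := inner_ge0 (v - w).
rewrite !(innerDl, innerDr, innerNl, innerNr) (innerC w v) vw !frobenius_sqr; lra.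
Qed.

End OrthonormalFamily.

(** With [V] the matrix of eigenvectors and [W] its columns divided by the eigenvalues, the identity
    of size [k] factors through [A] as [V^T *m A *m W]. *)
Lemma rank_ge_orthonormal {m k} (A : 'M[R]_m) (u : nat -> 'cV[R]_m) (l : nat -> R) :
  (forall i j, (i < k)%N -> (j < k)%N -> inner (u i) (u j) = (i == j)%:R) ->
  (forall i, (i < k)%N -> A *m u i = l i *: u i /\ l i != 0) ->
  (k <= \rank A)%N.
Proof.
move=> uu Au; pose V : 'M[R]_(m, k) := \matrix_(i, j) u j i 0.
pose W : 'M[R]_(m, k) := \matrix_(i, j) ((l j)^-1 * u j i 0).
have VV : V^T *m V = 1%:M.
  apply/matrixP => i j; rewrite !mxE -[RHS](uu i j) ?ltn_ord// innerE.
  by apply: eq_bigr => a _; rewrite big_ord1 !mxE.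
have AW : A *m W = V.
  apply/matrixP => i j; have [Auj lj] := Au j (ltn_ord j).
  have /matrixP/(_ i 0) := Auj; rewrite !mxE => h.
  rewrite -[RHS](mulKf lj) -h mulr_sumr; apply: eq_bigr => a _.
  by rewrite mxE mulrCA.
rewrite -[leqLHS](mxrank1 R) -VV -AW mulmxA (leq_trans (mxrankM_maxl _ _))//.
exact: mxrankM_maxr.
Qed.

End SingularValues.

(** * Exact deflations and the spectral gap *)

Section Chain.
Context {R : realType} {m rA : nat} (A : 'M[R]_m) (kappa : R).
Hypotheses (Apsd : psdmx A) (rankA : \rank A = rA) (kappa1 : 1 < kappa)
  (sv1 : singular_value A 1 = 1) (svr : singular_value A rA = 1 / kappa)
  (gap : forall i : nat, (1 <= i <= rA.-1)%N ->
     2 <= singular_value A i / singular_value A i.+1).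
Let lam j := singular_value A j.+1.

Lemma singular_value_bounds j : (j < rA)%N -> 1 / kappa <= lam j <= 1.
Proof.
move=> jr; rewrite -svr singular_value_anti//=.
by apply: le_trans (_ : singular_value A 1 <= _); rewrite ?singular_value_anti ?sv1.
Qed.

(** [M j] is the tail of the spectral sum from [j] on. On the orthogonal complement of [u j] it acts
    as [M j.+1], whose largest eigenvalue is at most half of [lam j] by the gap. *)
Lemma deflation_chain : exists (u : nat -> 'cV[R]_m) (M : nat -> 'M[R]_m),
  M 0%N = A /\ M rA = 0 /\ forall j, (j < rA)%N -> [/\ (M j)^T = M j,
    M j *m u j = lam j *: u j, frobenius (u j) = 1,
    (forall v, inner (u j) v = 0 ->
       frobenius (M j *m v) <= lam j / 2 * frobenius v) &
    M j.+1 = M j - lam j *: (u j *m (u j)^T)].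
Proof.
have [u [uu AE]] := psd_singular_decomposition A Apsd.
have rm : (rA <= m)%N by rewrite -rankA rank_leq_row.
pose M j := \sum_(j <= i < m) lam i *: (u i *m (u i)^T).
have MT j : (M j)^T = M j.
  rewrite /M raddf_sum; apply: eq_bigr => i _ /=.
  by rewrite linearZ/= trmx_mul trmxK.
have Mv j v : M j *m v = \sum_(j <= i < m) (lam i * inner (u i) v) *: u i.
  rewrite /M mulmx_suml; apply: eq_bigr => i _.
  by rewrite -scalemxAl outer_mul scalerA.
have MS j : (j < m)%N -> M j = lam j *: (u j *m (u j)^T) + M j.+1.
  by move=> jm; rewrite /M big_ltn.
have Mu a j : (a <= j < m)%N -> M a *m u j = lam j *: u j.
  move=> /andP[aj jm]; rewrite Mv (bigD1_seq j) ?mem_index_iota ?aj ?iota_uniq//=.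
  rewrite uu// eqxx mulr1 big_seq_cond big1 ?addr0// => i.
  rewrite mem_index_iota => /andP[/andP[_ im] ij].
  by rewrite uu// (negPf ij) mulr0 scale0r.
have A0 : M 0%N = A by rewrite AE.
(* A positive [lam rA] would give [rA.+1] orthonormal eigenvectors with nonzero eigenvalues, against
   the rank; if [rA = m], then [lam rA] is the default 0. *)
have lam0 j : (rA <= j)%N -> lam j = 0.
  move=> rj; apply/eqP; rewrite eq_le singular_value_ge0 andbT.
  rewrite (le_trans (singular_value_anti A rA.+1 j.+1 _))// leNgt.
  apply/negP => l0; have l0' i : (i < rA.+1)%N -> lam i != 0.
    by move=> ir; rewrite gt_eqF// (lt_le_trans l0)// singular_value_anti.
  have rAm : (rA < m)%N.
    rewrite ltn_neqAle rm andbT; apply/eqP => rAm; move: l0; rewrite rAm.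
    have [_ [d [_ _ /perm_size]]] := psd_spectral A Apsd.
    by rewrite size_map size_enum_ord /singular_value => sz; rewrite nth_default ?sz// ltxx.
  have := @rank_ge_orthonormal _ _ rA.+1 A u lam.
  rewrite rankA ltnn => h; suff : false by []; apply: h.
    by move=> i j' ir jr; rewrite uu// (leq_trans _ rAm).
  by move=> i ir; rewrite l0' -?A0 ?Mu//= (leq_trans _ rAm).
have Mr : M rA = 0.
  rewrite /M big_seq big1// => i; rewrite mem_index_iota => /andP[ri _].
  by rewrite lam0// scale0r.
exists u, M; split=> //; split=> // j jr; have jm := leq_trans jr rm.
split=> //.
- by rewrite Mu// leqnn.
- by apply/frobenius_unit; rewrite uu// eqxx.
- move=> v uv.
  have -> : M j *m v = M j.+1 *m v.
    by rewrite MS// mulmxDl -scalemxAl outer_mul uv scale0r scaler0 add0r.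
  (* The gap hypothesis covers all rounds but the last, where [lam j.+1] is 0. *)
  have lj : lam j.+1 <= lam j / 2.
    have [j1r|rj1] := ltnP j.+1 rA; last by rewrite lam0// divr_ge0// singular_value_ge0.
    have lp : 0 < lam j.+1.
      have /andP[+ _] := singular_value_bounds _ j1r; apply: lt_le_trans.
      by rewrite divr_gt0// (lt_trans _ kappa1).
    have := gap j.+1; rewrite ler_pdivlMr// => h.
    rewrite ler_pdivlMr// mulrC h// ltn0Sn/=.
    by case: (rA) j1r.
  apply: le_trans (ler_wpM2r (frobenius_ge0 _) lj).
  rewrite -(@ler_pXn2r _ 2)// ?nnegrE ?mulr_ge0 ?frobenius_ge0 ?singular_value_ge0//.
  rewrite Mv frobenius_orthonormal_sum// exprMn.
  apply: le_trans (ler_wpM2l (sqr_ge0 _) (bessel _ _ uu j.+1 v)).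
  rewrite mulr_sumr !big_seq; apply: ler_sum => i; rewrite mem_index_iota => /andP[ji _].
  rewrite exprMn ler_wpM2r ?sqr_ge0// lerXn2r// ?nnegrE ?singular_value_ge0//.
  exact: singular_value_anti.
- by rewrite (MS j)// addrC addKr.
Qed.
End Chain.

(** * Measurability of the algorithm *)

Section Measurability.
Context {R : realType} {d : measure_display} {Omega : measurableType d}.

(** Taken entrywise, so that matrix operations reduce to sums and products of real functions. *)
Definition mx_measurable {p q} (F : Omega -> 'M[R]_(p, q)) :=
  forall i j, measurable_fun setT (fun w => F w i j).

Lemma open_borel_vec {m} (U : set 'cV[R]_m) : open U -> borel_vec R m U.
Proof. by move=> oU; apply: sub_sigma_algebra. Qed.

Lemma random_vector_measurable {m} (X : Omega -> 'cV[R]_m) :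
  random_vector X -> mx_measurable X.
Proof.
move=> rX i j; apply: (measurability _ (RGenOpens.measurableE R)) => _ [_ [a [b ->]] <-].
rewrite setTI; apply: (rX [set x : 'cV[R]_m | (x i j \in `]a, b[)%R]).
apply: open_borel_vec; have /continuousP := @coord_continuous R m 1 i j.
by move=> /(_ `]a, b[%classic); apply; exact: interval_open.
Qed.

Lemma mx_measurable_cst {p q} (A : 'M[R]_(p, q)) : mx_measurable (fun=> A).
Proof. by move=> i j; exact: measurable_cst. Qed.

Lemma mx_measurableD {p q} (F G : Omega -> 'M[R]_(p, q)) :
  mx_measurable F -> mx_measurable G -> mx_measurable (fun w => F w + G w).
Proof.
by move=> mF mG i j; under eq_fun do rewrite mxE; exact: measurable_funD.
Qed.

Lemma mx_measurableZ {p q} (f : Omega -> R) (F : Omega -> 'M[R]_(p, q)) :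
  measurable_fun setT f -> mx_measurable F -> mx_measurable (fun w => f w *: F w).
Proof.
by move=> mf mF i j; under eq_fun do rewrite mxE; exact: measurable_funM.
Qed.

Lemma mx_measurableB {p q} (F G : Omega -> 'M[R]_(p, q)) :
  mx_measurable F -> mx_measurable G -> mx_measurable (fun w => F w - G w).
Proof.
by move=> mF mG i j; under eq_fun do rewrite !mxE; exact: measurable_funB.
Qed.

Lemma mx_measurableT {p q} (F : Omega -> 'M[R]_(p, q)) :
  mx_measurable F -> mx_measurable (fun w => (F w)^T).
Proof. by move=> mF i j; under eq_fun do rewrite mxE; exact: mF. Qed.

Lemma mx_measurableM {p q r} (F : Omega -> 'M[R]_(p, q)) (G : Omega -> 'M[R]_(q, r)) :
  mx_measurable F -> mx_measurable G -> mx_measurable (fun w => F w *m G w).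
Proof.
move=> mF mG i j; under eq_fun do rewrite mxE.
by apply: measurable_sum => k; exact: measurable_funM.
Qed.

Lemma measurable_frobenius {p q} (F : Omega -> 'M[R]_(p, q)) :
  mx_measurable F -> measurable_fun setT (fun w => frobenius (F w)).
Proof.
move=> mF; apply: (@measurableT_comp _ _ _ _ _ _ (@Num.sqrt R)).
  by apply: nondecreasing_measurable => // x y; exact: ler_wsqrtr.
by apply: measurable_sum => i; apply: measurable_sum => j; exact: measurable_funX.
Qed.

Lemma measurable_rayleigh {m} (B : Omega -> 'M[R]_m) (X : Omega -> 'cV[R]_m) :
  mx_measurable B -> mx_measurable X ->
  measurable_fun setT (fun w => rayleigh (B w) (X w)).
Proof.
move=> mB mX; apply: mx_measurableM => //.
by apply: mx_measurableM => //; exact: mx_measurableT.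
Qed.

Lemma mx_measurable_direction_step {m} eta (B : Omega -> 'M[R]_m) (X : Omega -> 'cV[R]_m) :
  mx_measurable B -> mx_measurable X ->
  mx_measurable (fun w => direction_step (B w) eta (X w)).
Proof.
move=> mB mX.
have my : mx_measurable
    (fun w => X w + eta *: ((1%:M - X w *m (X w)^T) *m B w *m X w)).
  apply: mx_measurableD => //; apply: mx_measurableZ; first exact: measurable_cst.
  apply: mx_measurableM => //; apply: mx_measurableM => //.
  apply: mx_measurableB; first exact: mx_measurable_cst.
  by apply: mx_measurableM => //; exact: mx_measurableT.
apply: mx_measurableZ => //.
(* The inverse is rewritten as a real power, which is a measurable function. *)
under eq_fun do rewrite euclidE -powR_inv1 ?frobenius_ge0//.
apply: (@measurableT_comp _ _ _ _ _ _ (fun x : R => x `^ (-1))) => //.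
exact: measurable_frobenius.
Qed.

Lemma measurable_rank1_dmd {m} (X : Omega -> 'cV[R]_m) (B : Omega -> 'M[R]_m) eta mu t :
  mx_measurable X -> mx_measurable B ->
  mx_measurable (fun w => (rank1_dmd (X w) (B w) eta mu t).1) /\
  measurable_fun setT (fun w => (rank1_dmd (X w) (B w) eta mu t).2).
Proof.
move=> mX mB.
have step Y (f : Omega -> R) : mx_measurable Y -> measurable_fun setT f ->
    measurable_fun setT (fun w => magnitude_step (B w) mu (Y w) (f w)).
  move=> mY mf; apply: measurable_funB => //; apply: measurable_funM => //.
  by apply: measurable_funB => //; exact: measurable_rayleigh.
elim: t => [|t [IH1 IH2]] /=; first by split=> //; apply: step.
have mD := mx_measurable_direction_step eta _ _ mB IH1.
by split=> //; apply: step.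
Qed.

Lemma mx_measurable_rank1_of {m} (X : Omega -> 'cV[R]_m) (B : Omega -> 'M[R]_m) eta mu t :
  mx_measurable X -> mx_measurable B ->
  mx_measurable (fun w => rank1_of (rank1_dmd (X w) (B w) eta mu t)).
Proof.
move=> mX mB; have [m1 m2] := measurable_rank1_dmd X B eta mu t mX mB.
by apply: mx_measurableZ => //; apply: mx_measurableM => //; exact: mx_measurableT.
Qed.

Lemma measurable_error_le {m} (eps : R) (F : Omega -> 'M[R]_m) : mx_measurable F ->
  measurable [set w | 1 / 4 * frobenius (F w) ^+ 2 <= eps].
Proof.
move=> mF; rewrite -[X in measurable X]setTI.
apply: (measurable_fun_le (f := fun w => 1 / 4 * frobenius (F w) ^+ 2) (g := cst eps)) => //.
apply: measurable_funM => //; apply: measurable_funX; exact: measurable_frobenius.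
Qed.

(** The generality serves the induction: [B] is random because deflated matrices are, [C] absorbs
    the terms already output, and [Q] is shifted to count rounds. The event splits along the first
    stopping test. *)
Lemma measurable_recursive_dmd {m} (Xs : seq (Omega -> 'cV[R]_m))
    (B C : Omega -> 'M[R]_m) (Q : nat -> Prop) eps eta mu T :
  (forall X, X \in Xs -> mx_measurable X) -> mx_measurable B -> mx_measurable C ->
  measurable [set w |
    let out := recursive_dmd (B w) eps eta mu T [seq X w | X <- Xs] in
    1 / 4 * frobenius (\sum_(o <- out) rank1_of o + C w) ^+ 2 <= eps /\
    Q (size out)].
Proof.
elim: Xs B C Q => [|X Xs IH] B C Q mXs mB mC /=.
  have [Q0|nQ0] := pselect (Q 0%N).
    rewrite (_ : [set w | _] = [set w | 1 / 4 * frobenius (C w) ^+ 2 <= eps]).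
      exact: measurable_error_le.
    by apply/seteqP; split=> [w [+ _]|w +] /=; rewrite big_nil add0r.
  by rewrite (_ : [set w | _] = set0)//; apply/seteqP; split=> w //= [].
have mX : mx_measurable X by apply: mXs; rewrite inE eqxx.
set o := fun w => rank1_dmd (X w) (B w) eta mu T.
have mo : mx_measurable (fun w => rank1_of (o w)) by exact: mx_measurable_rank1_of.
have mB' : mx_measurable (fun w => B w - rank1_of (o w)) by exact: mx_measurableB.
have mC' : mx_measurable (fun w => rank1_of (o w) + C w) by exact: mx_measurableD.
pose c := [set w | 1 / 4 * frobenius (B w - rank1_of (o w)) ^+ 2 <= eps].
have mc : measurable c by exact: measurable_error_le.
pose S1 := [set w | 1 / 4 * frobenius (rank1_of (o w) + C w) ^+ 2 <= eps /\ Q 1%N].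
have mS1 : measurable S1.
  have [Q1|nQ1] := pselect (Q 1%N).
    rewrite (_ : S1 = [set w | 1 / 4 * frobenius (rank1_of (o w) + C w) ^+ 2 <= eps]).
      exact: measurable_error_le.
    by apply/seteqP; split=> [w []|w].
  by rewrite (_ : S1 = set0)//; apply/seteqP; split=> w //= [].
have mS2 := IH _ _ (fun n => Q n.+1) (fun Y hY => mXs Y (mem_behead (s := X :: Xs) hY)) mB' mC'.
set S2 := (X in measurable X) in mS2.
rewrite (_ : [set w | _] = (c `&` S1) `|` (~` c `&` S2)).
  by apply: measurableU; apply: measurableI => //; exact: measurableC.
apply/seteqP; split=> w /=; rewrite -/(o w) /c /S1 /S2 /=.
  case: ifPn => [cw|/negP cw]; rewrite big_cons.
    by rewrite big_nil addr0 => ?; left.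
  by rewrite addrAC [_ + C w + _]addrC => ?; right.
case: ifPn => [cw|/negP cw]; rewrite big_cons.
  by rewrite big_nil addr0 => -[[]//|[]//].
by rewrite addrAC [_ + C w + _]addrC => -[[]//|[]//].
Qed.

End Measurability.

(** * Anti-concentration of the uniform distribution *)

Section AntiConcentration.
Context {R : realType}.

(** The shift to [1, ..., K] keeps the vectors nonzero, so that they can be normalised. *)
Definition grid_vec {m K} (g : {ffun 'I_m -> 'I_K}) : 'cV[R]_m :=
  \col_i (g i).+1%:R.

Lemma grid_vec_bounds {n K} (g : {ffun 'I_n.+1 -> 'I_K}) :
  0 < frobenius (grid_vec g) <= n.+1%:R * K%:R.
Proof.
apply/andP; split.
  rewrite lt_def frobenius_ge0 andbT; apply/eqP => /frobenius_eq0.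
  by move=> /matrixP/(_ 0 0); rewrite !mxE => /eqP; rewrite pnatr_eq0.
rewrite -(@ler_pXn2r _ 2)// ?nnegrE ?mulr_ge0 ?frobenius_ge0//.
rewrite frobenius_sqr innerE exprMn.
apply: (@le_trans _ _ (\sum_(i < n.+1) K%:R ^+ 2)).
  apply: ler_sum => i _; rewrite big_ord1 !mxE -expr2.
  by rewrite lerXn2r// ?nnegrE// ler_nat.
rewrite sumr_const card_ord -[leLHS]mulr_natl ler_wpM2r ?sqr_ge0//.
by rewrite ler_eXnr// ler1n.
Qed.

(** Otherwise every squared coordinate is below [1 / n.+1] and their sum is below 1. *)
Lemma unit_large_coord {n} (x : 'cV[R]_n.+1) : frobenius x = 1 ->
  exists k, 1 <= n.+1%:R * `|x k 0|.
Proof.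
move=> x1; apply: contrapT => /forallNP h.
have hk k : x k 0 ^+ 2 < n.+1%:R^-1.
  have /negP := h k; rewrite -ltNge => hk.
  have n0 : 0 < n.+1%:R :> R by [].
  have xk : `|x k 0| < n.+1%:R^-1 by rewrite -(ltr_pM2l n0) mulfV// gt_eqF.
  rewrite -real_normK ?num_real// expr2.
  apply: le_lt_trans (xk); rewrite ler_piMl//.
  by rewrite (le_trans (ltW xk))// invf_le1// ler1n.
have := frobenius_sqr x; rewrite x1 expr1n innerE => /eqP; apply/negP.
rewrite gt_eqF//; apply: (@lt_le_trans _ _ (\sum_(i < n.+1) n.+1%:R^-1)).
  apply: ltr_sum => [|i _]; last by rewrite big_ord1 -expr2.
  by apply/hasP; exists ord0; rewrite // mem_index_enum.
by rewrite sumr_const card_ord -[leLHS]mulr_natr mulVf.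
Qed.

(** Forgetting the coordinate [k] with [x k 0] large is injective on the slab: two points that agree
    elsewhere have inner products with [x] differing by [((g k)%:R - (g' k)%:R) * x k 0], which is
    too small for distinct integers. *)
Lemma card_grid_slab {n K} (x : 'cV[R]_n.+1) (delta : R) :
  frobenius x = 1 -> 2 * n.+1%:R ^+ 2 * K%:R * delta <= 1 ->
  (#|[set g : {ffun 'I_n.+1 -> 'I_K} |
      (`|inner (grid_vec g) x| < delta * frobenius (grid_vec g))%R]%SET| <= K ^ n)%N.
Proof.
move=> x1 dle; have [k xk] := unit_large_coord x x1.
pose f (g : {ffun 'I_n.+1 -> 'I_K}) := [ffun j : 'I_n => g (lift k j)].
have -> : (K ^ n = #|{ffun 'I_n -> 'I_K}|)%N by rewrite card_ffun !card_ord.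
apply: (@leq_card_in _ _ f) => g g'; rewrite !inE => hg hg' /ffunP fE.
have gE j : j != k -> g j = g' j.
  rewrite eq_sym => /unlift_some[j' -> _]; by have := fE j'; rewrite !ffunE.
have diff : inner (grid_vec g) x - inner (grid_vec g') x = ((g k)%:R - (g' k)%:R) * x k 0.
  rewrite !innerE -sumrB (bigD1 k)//= !big_ord1 !mxE big1 ?addr0.
    by rewrite -!natr1; ring.
  by move=> l lk; rewrite !big_ord1 !mxE gE// subrr.
have [g0 gM] := andP (grid_vec_bounds g); have [g'0 g'M] := andP (grid_vec_bounds g').
have d0 : 0 <= delta.
  by rewrite -(pmulr_lge0 _ g0) (le_trans _ (ltW hg)).
(* The two slab bounds sum to at most [2 * n.+1 * K * delta], hence to at most the absolute value of
   [x k 0] by the choice of [k] and the hypothesis on [delta]. *)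
have hlt : `|(g k)%:R - (g' k)%:R| < 1 :> R.
  have x0 : 0 < `|x k 0|.
    by rewrite lt_def normr_ge0 andbT; apply: contraTneq xk => ->; rewrite mulr0 ler10.
  rewrite -(ltr_pM2r x0) -normrM -diff mul1r.
  apply: le_lt_trans (ler_normB _ _) _; apply: lt_le_trans (ltrD hg hg') _.
  apply: (@le_trans _ _ (2 * n.+1%:R ^+ 2 * K%:R * delta * `|x k 0|)); last first.
    by rewrite ler_piMl.
  apply: (@le_trans _ _ (2 * n.+1%:R * K%:R * delta)).
    rewrite -mulrDr mulrC ler_wpM2r//; lra.
  rewrite [leRHS](_ : _ = 2 * n.+1%:R * K%:R * delta * (n.+1%:R * `|x k 0|)); last by ring.
  by rewrite ler_peMr// !mulr_ge0.
apply/ffunP => j; have [->|] := eqVneq j k; last exact: gE.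
apply/val_inj/eqP; rewrite /= eqn_leq; move: hlt; rewrite ltr_norml => /andP[h1 h2].
by apply/andP; split; rewrite -ltnS -(ltr_nat R) -natr1; lra.
Qed.

Lemma slab_borel {m} (u : 'cV[R]_m) (c : R) :
  borel_vec R m [set x | `|inner u x| < c].
Proof.
(* The identity is a random vector on the Borel space itself. *)
pose T := g_sigma_algebraType [set U : set 'cV[R]_m | open U].
have mid : mx_measurable (fun x : T => x : 'cV[R]_m).
  by apply: random_vector_measurable => B.
suff : measurable [set x : T | `|inner u x| < c] by [].
rewrite (_ : mkset _ = ~` (setT `&` [set x : T | c <= `|inner u x|])); last first.
  by rewrite setTI; apply/seteqP; split=> x /=; rewrite ltNge => /negP.
apply: measurableC.
apply: (measurable_fun_le (f := cst c) (g := fun x : T => `|inner u x|)) => //.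
apply: (@measurableT_comp _ _ _ _ _ _ (fun x : R => `|x|)) => //.
rewrite (_ : inner u = fun x => \sum_i \sum_j u i j * x i j); last first.
  by apply/funext => x; rewrite innerE.
apply: measurable_sum => i; apply: measurable_sum => j.
by apply: measurable_funM => //; exact: mid.
Qed.

Context {d : measure_display} {Omega : measurableType d} (P : probability Omega R).

(** Double counting: the sum is the expected number of events that occur. *)
Lemma sum_probability_le {I : finType} (E : I -> set Omega) (N : nat) :
  (forall i, measurable (E i)) ->
  (forall w, (#|[set i | w \in E i]%SET| <= N)%N) ->
  (\sum_i P (E i) <= N%:R%:E)%E.
Proof.
move=> mE EN.
have -> : (\sum_i P (E i) = \int[P]_w (\sum_i (\1_(E i) w)%:E))%E.
  rewrite ge0_integral_sum//; first by apply: eq_bigr => i _; rewrite integral_indic// setIT.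
  by move=> i; apply/measurable_EFinP; exact: measurable_indic.
apply: (@le_trans _ _ (\int[P]_w (cst N%:R%:E w))%E); last first.
  by rewrite integral_cst//= probability_setT mule1.
apply: ge0_le_integral => //.
- by move=> w _; apply: sume_ge0 => i _; rewrite lee_fin indicE.
- by apply: emeasurable_sum => i; apply/measurable_EFinP; exact: measurable_indic.
- move=> w _ /=; rewrite sumEFin lee_fin.
  under eq_bigr do rewrite indicE.
  rewrite -natr_sum ler_nat (leq_trans _ (EN w))// -sum1dep_card.
  by rewrite [leqRHS]big_mkcond; apply: leq_sum => i _; case: (_ \in _).
Qed.

(** By invariance all [K ^ n.+1] grid directions have the same slab probability as [u], and at most
    [K ^ n] of these slabs occur at once. *)
Lemma slab_probability_le {n K} (X : Omega -> 'cV[R]_n.+1) (u : 'cV[R]_n.+1)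
    (delta : R) : (0 < K)%N -> uniform_on_sphere P X -> frobenius u = 1 ->
  2 * n.+1%:R ^+ 2 * K%:R * delta <= 1 ->
  (P [set w | (`|inner u (X w)| < delta)%R] <= (K%:R^-1)%:E)%E.
Proof.
move=> K0 [rX X1 XQ] u1 dle; pose slab := [set x : 'cV[R]_n.+1 | `|inner u x| < delta].
have X1' w : frobenius (X w) = 1.
  by apply/frobenius_unit; rewrite /inner X1 mxtrace1.
have slabB : borel_vec R n.+1 slab by exact: slab_borel.
pose E (g : {ffun 'I_n.+1 -> 'I_K}) :=
  [set w | `|inner (grid_vec g) (X w)| < delta * frobenius (grid_vec g)].
have mE g : measurable (E g) by exact: (rX _ (slab_borel _ _)).
have PE g : P (E g) = P (X @^-1` slab).
  have /andP[g0 _] := grid_vec_bounds g.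
  have v1 : frobenius ((frobenius (grid_vec g))^-1 *: grid_vec g) = 1.
    by rewrite frobeniusZ ger0_norm ?invr_ge0 ?frobenius_ge0// mulVf// gt_eqF.
  have [Q QQ Qv] := orthogonal_transitive _ u v1 u1.
  have EE : E g = [set w | slab (Q *m X w)].
    have h w : inner u (Q *m X w) = (frobenius (grid_vec g))^-1 * inner (grid_vec g) (X w).
      by rewrite -Qv inner_orthogonal// innerZl.
    by apply/seteqP; split=> w; rewrite /slab /E/= h normrM gtr0_norm ?invr_gt0//
      [_^-1 * _]mulrC ltr_pdivrMr.
  by rewrite EE XQ.
have EN w : (#|[set g | w \in E g]%SET| <= K ^ n)%N.
  apply: leq_trans (card_grid_slab (X w) delta (X1' w) dle).
  by apply: subset_leq_card; apply/fintype.subsetP => g; rewrite !inE.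
have := sum_probability_le E (K ^ n) mE EN.
have pE : (fine (P (X @^-1` slab)))%:E = P (X @^-1` slab).
  by rewrite fineK//; apply: fin_num_measure; exact: rX.
under eq_bigr do rewrite PE -pE.
rewrite -[X in (X <= K%:R^-1%:E)%E]pE sumEFin !lee_fin sumr_const card_ffun !card_ord.
have Kn0 : 0 < K%:R :> R by rewrite ltr0n.
rewrite -[X in X <= _ -> _]mulr_natr expnS natrM natrX mulrA => h.
by rewrite -[K%:R^-1]mul1r ler_pdivlMr// -(ler_pM2r (exprn_gt0 n Kn0)) mul1r.
Qed.

End AntiConcentration.

(** * Choice of the constants *)

Lemma expR_ge1 {R : realType} (x : R) : 0 <= x -> 1 <= expR x.
Proof. by move=> x0; rewrite (le_trans _ (expR_ge1Dx x))// lerDl. Qed.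

(** [K] is about [expR ((c + 1) * L)], where the extra [L] pays for the union bound since
    [rA <= expR L]. In [delta^-1 = 2 * m ^ 2 * K], the factors 4 (including the 2 from rounding [K])
    and [m ^ 2] each cost [2 * L], whence [c + 5]. *)
Lemma failure_budget {R : realType} (c L : R) (m rA : nat) : 0 < c ->
  (3 <= m)%N -> L = ln m%:R + rA%:R -> (1 <= rA)%N ->
  exists (K : nat) (delta : R), [/\ (0 < K)%N, 0 < delta <= 1,
    2 * m%:R ^+ 2 * K%:R * delta <= 1,
    rA%:R * K%:R^-1 <= expR (- c * L) &
    delta^-1 <= expR ((c + 5) * L)].
Proof.
move=> c0 m3 LE rA1.
have m0 : 0 < m%:R :> R by rewrite ltr0n (leq_trans _ m3).
have lnm0 : 0 <= ln m%:R :> R by rewrite ln_ge0// ler1n (leq_trans _ m3).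
have L1 : 1 <= L.
  by rewrite LE (le_trans (_ : 1 <= rA%:R))// ?ler1n// lerDr.
have two_le : 2 <= expR 1 :> R by rewrite (le_trans _ (expR_ge1Dx 1)).
have m_le : m%:R <= expR L.
  by rewrite LE expRD lnK// ler_peMr ?expR_ge1// ltW.
have rA_le : rA%:R <= expR L.
  have h := expR_ge1Dx (L : R); rewrite (le_trans _ h)// LE; lra.
pose y := expR ((c + 1) * L).
have y1 : 1 <= y by rewrite expR_ge1// mulr_ge0//; lra.
pose K := (Num.truncn y).+1; exists K.
have K0 : 0 < K%:R :> R by rewrite ltr0n.
have yK : y <= K%:R by rewrite ltW// truncnS_gt.
have Ky : K%:R <= 2 * y.
  have tr : (Num.truncn y)%:R <= y by rewrite truncn_le (le_trans ler01 y1).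
  have -> : K%:R = (Num.truncn y)%:R + 1 :> R by rewrite natr1.
  lra.
exists (2 * m%:R ^+ 2 * K%:R)^-1.
have D0 : 0 < 2 * m%:R ^+ 2 * K%:R :> R by rewrite !mulr_gt0// exprn_gt0.
split=> //.
- rewrite invr_gt0 D0/= invf_le1//.
  have -> : 2 * m%:R ^+ 2 * K%:R = (2 * m ^ 2 * K)%:R :> R by rewrite !natrM expr2.
  by rewrite ler1n !muln_gt0 (leq_trans _ m3).
- by rewrite mulfV ?gt_eqF.
- rewrite ler_pdivrMr//; apply: (@le_trans _ _ (expR (- c * L) * y)); last first.
    by rewrite ler_wpM2l ?expR_ge0.
  rewrite /y -expRD (le_trans rA_le)// ler_expR; lra.
- rewrite invrK; apply: (@le_trans _ _ (expR (2 * L) * expR L ^+ 2 * y)).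
    have four : 4 <= expR (2 * L).
      rewrite (@le_trans _ _ (expR 1 ^+ 2))//.
        rewrite (_ : 4 = 2 ^+ 2); last by rewrite expr2; ring.
        by rewrite lerXn2r ?nnegrE ?expR_ge0.
      by rewrite -expRM_natl ler_expR mulr1; lra.
    rewrite (_ : 2 * _ * _ = 2 * (m%:R ^+ 2 * K%:R)); last by ring.
    apply: (@le_trans _ _ (4 * (expR L ^+ 2 * y))).
      rewrite (_ : 4 * _ = 2 * (expR L ^+ 2 * (2 * y))); last by ring.
      have m2 : m%:R ^+ 2 <= expR L ^+ 2 by rewrite lerXn2r ?nnegrE ?expR_ge0 ?ler0n.
      by rewrite ler_wpM2l// ler_pM// sqr_ge0.
    by rewrite -mulrA ler_wpM2r// mulr_ge0 ?sqr_ge0// expR_ge0.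
  by rewrite /y -expRM_natl -!expRD ler_expR; lra.
Qed.

(** The constant is [2 * c + 19 = 2 * (c + 5) + 5 + 4]: [delta] enters on both sides, [32 ^+ rA]
    costs [5 * L] and 16 costs [4 * L]. The prefactor [10 / eta1] compensates the rate
    [eta1 / (10 * kappa)]. *)
Lemma iteration_budget {R : realType} (c L delta eta1 eta kappa eps : R) (rA T : nat) :
  0 < c -> 1 <= L -> rA%:R <= L -> 0 < eta1 <= eta -> eta <= 1 / 4 -> 1 < kappa ->
  0 < eps <= 1 -> 0 < delta -> delta^-1 <= expR ((c + 5) * L) ->
  10 * (2 * c + 19) / eta1 * (kappa * L + kappa * ln (1 / eps)) <= T%:R ->
  (1 - eta * (1 / kappa) / 10) ^+ T / delta * 32 ^+ rA <= delta * eps / 16.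
Proof.
move=> c0 L1 rL /andP[e10 e1] e4 k1 /andP[p0 p1] d0 dle hT.
have k0 := lt_trans ltr01 k1.
have le0 : 0 <= ln (1 / eps) by rewrite ln_ge0// ler_pdivlMr// mul1r.
pose x := eta1 / (10 * kappa).
have xT : (2 * c + 19) * L + ln (1 / eps) <= x * T%:R.
  have x0 : 0 <= x by rewrite divr_ge0 ?mulr_ge0 ?(ltW e10) ?(ltW k0).
  apply: le_trans (ler_wpM2l x0 hT).
  rewrite /x (_ : _ * (_ * _) = (2 * c + 19) * L + (2 * c + 19) * ln (1 / eps)).
    by rewrite lerD2l ler_peMl//; lra.
  by field; rewrite ?gt_eqF.
have base0 : 0 <= 1 - eta * (1 / kappa) / 10.
  have : eta * (1 / kappa) <= 1; last by lra.
  by rewrite mul1r ler_pdivrMr// mul1r; lra.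
have pow : (1 - eta * (1 / kappa) / 10) ^+ T <= expR (- (x * T%:R)).
  rewrite -(mulNr x) expRM_natr.
  have h : 1 - eta * (1 / kappa) / 10 <= expR (- x).
    apply: le_trans (expR_ge1Dx _); rewrite lerD2l lerN2 /x.
    have -> : eta1 / (10 * kappa) = eta1 * (1 / kappa) / 10 by field; rewrite gt_eqF.
    by rewrite !ler_wpM2r// ?invr_ge0// divr_ge0// ltW.
  by rewrite lerXn2r ?nnegrE ?expR_ge0.
have two_le : 2 <= expR 1 :> R by rewrite (le_trans _ (expR_ge1Dx 1)).
have b16 : 16 <= expR (4 * L).
  rewrite (@le_trans _ _ (expR 1 ^+ 4))//.
    rewrite (_ : 16 = 2 ^+ 4); last by rewrite !exprS expr0; ring.
    by rewrite lerXn2r ?nnegrE ?expR_ge0.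
  by rewrite -expRM_natl ler_expR mulr1; lra.
have b32 : 32 ^+ rA <= expR (5 * L).
  apply: (@le_trans _ _ ((expR 1 ^+ 5) ^+ rA)).
    rewrite lerXn2r ?nnegrE ?exprn_ge0 ?expR_ge0//.
    rewrite (_ : 32 = 2 ^+ 5); last by rewrite !exprS expr0; ring.
    by rewrite lerXn2r ?nnegrE ?expR_ge0.
  by rewrite -!expRM_natl ler_expR; lra.
have dge : expR (- ((c + 5) * L)) <= delta.
  by rewrite expRN -[leRHS]invrK lef_pV2 ?posrE ?invr_gt0 ?expR_gt0.
have epsE : eps = expR (- ln (1 / eps)).
  by rewrite expRN lnK ?posrE div1r ?invr_gt0// invrK.
have b16' : expR (- (4 * L)) <= 16^-1 by rewrite expRN lef_pV2 ?posrE ?expR_gt0.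
apply: (@le_trans _ _ (expR (- (x * T%:R)) * expR ((c + 5) * L) * expR (5 * L))).
  by rewrite !ler_pM// ?mulr_ge0 ?exprn_ge0 ?invr_ge0 ?(ltW d0)// base0.
apply: (@le_trans _ _ (expR (- ((c + 5) * L)) * expR (- ln (1 / eps)) * expR (- (4 * L)))).
  by rewrite -!expRD ler_expR; lra.
by rewrite !ler_pM ?mulr_ge0 ?expR_ge0// -epsE.
Qed.

(** High probability means failure at most [expR (- c * (ln m + rA))] for an arbitrary fixed [c].
    The orders of magnitude are explicit: [eta] lies between constants, [Tstar] between [C1] and
    [C2] times its order, and [C2] also bounds the total. *)
Theorem theorem8 (R : realType) :
  exists eta0 : R, 0 < eta0 /\
  forall eta1 c : R, 0 < eta1 <= eta0 -> 0 < c ->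
  exists C1 : R, 0 < C1 /\
  forall C2 : R, C1 <= C2 ->
  forall (m rA r : nat) (A : 'M[R]_m) (kappa eps eta : R) (Tstar : nat)
    (d : measure_display) (Omega : measurableType d) (P : probability Omega R)
    (X0 : 'I_r -> Omega -> 'cV[R]_m),
  (3 <= m)%N ->
  psdmx A -> \rank A = rA ->
  1 < kappa ->
  singular_value A 1 = 1 ->
  singular_value A rA = 1 / kappa ->
  (forall i : nat, (1 <= i <= rA.-1)%N ->
     2 <= singular_value A i / singular_value A i.+1) ->
  (rA < r)%N ->
  0 < eps < 1 / kappa ^+ 2 ->
  eta1 <= eta <= eta0 ->
  C1 * (kappa * (ln m%:R + rA%:R) + kappa * ln (1 / eps)) <= Tstar%:R
    <= C2 * (kappa * (ln m%:R + rA%:R) + kappa * ln (1 / eps)) ->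
  (forall j, uniform_on_sphere P (X0 j)) ->
  independent_vectors P X0 ->
  let success := [set w |
    let out :=
      recursive_dmd A eps eta 2 Tstar [seq X0 j w | j <- enum 'I_r] in
    let J := size out in
    [/\ 1 / 4 * frobenius (\sum_(o <- out) rank1_of o - A) ^+ 2 <= eps,
        (J <= rA)%N &
        (J * Tstar)%:R <=
          C2 * (kappa * (rA%:R * ln m%:R + rA%:R ^+ 2)
                + rA%:R * kappa * ln (1 / eps))]] in
  ((1 - expR (- c * (ln m%:R + rA%:R)))%:E <= P success)%E.
Proof.
exists (1 / 4); split=> // eta1 c /andP[e10 e14] c0.
exists (10 * (2 * c + 19) / eta1); split; first by rewrite divr_gt0//; lra.
move=> C2 C12 [|n] rA [|r] A kappa eps eta Tstar d Omega P X0 // m3 Apsd rankA k1 sv1 svr.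
move=> gap rAr /andP[p0 p1] /andP[ee1 ee4] /andP[T1 T2] unif _ /=.
set success := mkset _.
have k0 := lt_trans ltr01 k1.
(* [singular_value A 0] reads the first singular value, so [rA = 0] would give [1 / kappa = 1]. *)
have rA0 : (0 < rA)%N.
  rewrite lt0n; apply/eqP => rA0; move: svr; rewrite rA0 -[X in X = _]/(singular_value A 1).
  by rewrite sv1 => /eqP; rewrite eq_sym div1r invr_eq1 gt_eqF.
set m := n.+1 in A Apsd X0 m3 rankA sv1 svr gap unif success T1 T2 *.
set L := ln m%:R + rA%:R in T1 T2 *.
have lnm0 : 0 <= ln m%:R :> R by rewrite ln_ge0// ler1n (leq_trans _ m3).
have rL : rA%:R <= L by rewrite lerDr.
have L1 : 1 <= L by rewrite (le_trans _ rL)// ler1n.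
have ik1 : 1 / kappa <= 1 by rewrite ler_pdivrMr// mul1r ltW.
have pk : eps <= 1 / kappa.
  rewrite (le_trans (ltW p1))// expr2 !div1r invfM ler_piMr ?invr_ge0 ?(ltW k0)//.
  by rewrite -div1r.
have p01 : 0 < eps <= 1 by rewrite p0 (le_trans pk).
have [K [delta [K0 d01 Kd fail dinv]]] := failure_budget c L m rA c0 m3 erefl rA0.
have /andP[d0 d1] := d01.
have budget := @iteration_budget R c L delta eta1 eta kappa eps rA Tstar c0 L1 rL
  (introT andP (conj e10 ee1)) ee4 k1 p01 d0 dinv T1.
have [u [M [M0 [Mr chain]]]] := deflation_chain A kappa Apsd rankA k1 sv1 svr gap.
have Xm j : mx_measurable (X0 j).
  by have [rX _ _] := unif j; exact: random_vector_measurable.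
have X1 j w : frobenius (X0 j w) = 1.
  by have [_ X1 _] := unif j; apply/frobenius_unit; rewrite /inner X1 mxtrace1.
have msuccess : measurable success.
  have mXs X : X \in map X0 (enum 'I_r.+1) -> mx_measurable X by move=> /mapP[j _ ->].
  have := measurable_recursive_dmd _ _ _
    (fun J => (J <= rA)%N /\ (J * Tstar)%:R <= C2 * (kappa * (rA%:R * ln m%:R + rA%:R ^+ 2)
                + rA%:R * kappa * ln (1 / eps))) eps eta 2 Tstar
    mXs (mx_measurable_cst A) (mx_measurable_cst (- A)).
  congr measurable; apply/seteqP; split=> w /=; rewrite -map_comp.
    by move=> [? [? ?]].
  by move=> [? ? ?].
(* [inord] turns the round number into an index of [X0]; it is faithful since [i < rA < r.+1]. *)
pose bad i := [set w | `|inner (u i) (X0 (inord i) w)| < delta].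
have mbad i : measurable (bad i).
  have [rX _ _] := unif (inord i); exact: (rX _ (slab_borel (u i) delta)).
have Pbad i : (i < rA)%N -> (P (bad i) <= (K%:R^-1)%:E)%E.
  move=> ir; have [_ _ u1 _ _] := chain i ir.
  exact: (slab_probability_le P _ _ delta K0 (unif (inord i)) u1 Kd).
(* Outside the bad events all overlaps are at least [delta], and the deterministic analysis applies
   with [rA] rounds left, starting from [M 0 = A] with error 0. *)
have sub : ~` success `<=` \big[setU/set0]_(i < rA) bad i.
  move=> w; apply: contra_notP => nbad.
  have ov i : (i < rA)%N -> delta <= `|inner (u i) (X0 (inord i) w)|.
    move=> ir; rewrite leNgt; apply/negP => wi; apply: nbad.
    by rewrite -bigcup_mkord; exists i.
  have nthE i : (i < rA)%N -> nth 0 [seq X0 j w | j <- enum 'I_r.+1] i = X0 (inord i) w.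
    move=> ir; have ir1 : (i < r.+1)%N := ltn_trans ir rAr.
    rewrite (nth_map ord0) ?size_enum_ord//; congr (X0 _ w).
    by apply/val_inj; rewrite /= nth_enum_ord// inordK.
  have := @recursive_dmd_success R m rA Tstar M u (fun j => singular_value A j.+1)
    kappa eps eta delta ((1 - eta * (1 / kappa) / 10) ^+ Tstar / delta)
    (fun j jr => let: And5 h _ _ _ _ := chain j jr in h)
    (fun j jr => let: And5 _ h _ _ _ := chain j jr in h)
    (fun j jr => let: And5 _ _ h _ _ := chain j jr in h)
    (singular_value_bounds A kappa sv1 svr)
    (fun j jr => let: And5 _ _ _ h _ := chain j jr in h)
    (fun j jr => let: And5 _ _ _ _ h := chain j jr in h)
    Mr k1 (introT andP (conj p0 pk)) (introT andP (conj (lt_le_trans e10 ee1) ee4))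
    d01 (lexx _) budget rA.-1 0%N A [seq X0 j w | j <- enum 'I_r.+1].
  have kE : (0 + rA.-1.+1 = rA)%N by rewrite add0n prednK.
  have A0 xi : frobenius (A - M 0%N) <= xi * (32 ^+ 0 - 1).
    by rewrite M0 subrr frobenius0 expr0 subrr mulr0.
  have sz : (rA.-1 < size [seq X0 j w | j <- enum 'I_r.+1])%N.
    by rewrite size_map size_enum_ord prednK// ltnW.
  move=> /(_ kE (A0 _) sz)[i ir|err].
    have ir' : (i < rA)%N by rewrite -(prednK rA0) ltnS.
    by rewrite nthE// X1 add0n; split=> //; exact: ov.
  rewrite prednK// => Jr.
  split=> //; apply: (@le_trans _ _ (rA%:R * Tstar%:R)).
    by rewrite natrM ler_wpM2r// ler_nat.
  apply: le_trans (ler_wpM2l _ T2) _; first by [].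
  by rewrite /L le_eqVlt; apply/orP; left; apply/eqP; ring.
have PS : P success = (1 - P (~` success))%E.
  by rewrite -probability_setC ?setCK//; exact: measurableC.
rewrite PS EFinB leeB//.
apply: (@le_trans _ _ (P (\big[setU/set0]_(i < rA) bad i))).
  apply: le_measure => //; rewrite inE; [exact: measurableC | exact: bigsetU_measurable].
apply: le_trans (Boole_inequality _ _) _ => //.
apply: (@le_trans _ _ (\sum_(i < rA) (K%:R^-1)%:E)%E).
  by apply: lee_sum => i _; exact: Pbad.
by rewrite sumEFin lee_fin sumr_const card_ord -[leLHS]mulr_natl.
Qed.
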